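(* (i) Upper bound. For every $c>0$ there is a constant $C\geq 1$, depending only on $c$, such that the following holds. Let $K \subset B(0,1) \subset \mathbb{R}^{2}$ be a compact set with $\mathcal{H}^{1}_{\infty}(K) \geq c$, let $1/2 \leq s < 1$, $0<\delta\leq 1/2$ and $\delta \leq r \leq 1$, and let $$E_{s} := \{e \in S^{1} : N(\pi_{e}(K),\delta) \leq \delta^{-s}\}.$$ Then $$N(E_{s},r) \leq C \log(1/\delta)\cdot \min\left\{\delta^{-s}\left(\frac{\delta}{r}\right)^{1/2},\frac{1}{r}\right\}.$$ (ii) Sharpness of the exponents for $\delta \leq r \leq \delta^{s}$. There are absolute constants $c_{0}>0$ and $C_{0}\geq 1$ such that for all $1/2 \leq s < 1$, $0<\delta\leq 1/2$ and $\delta \leq r \leq \delta^{s}$ there exists a compact set $K \subset B(0,1)\subset\mathbb{R}^2$ with $\mathcal{H}^{1}_{\infty}(K) \geq c_{0}$ such that $$N\left(\{e \in S^{1} : N(\pi_{e}(K),\delta) \leq C_{0}\,\delta^{-s}\},\, r\right) \geq c_{0}\,\delta^{-s}\left(\frac{\delta}{r}\right)^{1/2}.$$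
   Context: $B(x,\rho)$ denotes the closed ball of centre $x$ and radius $\rho$. For $e \in S^{1}$ (the unit circle in $\mathbb{R}^2$), $\pi_{e}$ is the orthogonal projection of $\mathbb{R}^{2}$ onto the line $\operatorname{span}(e)$. For a bounded set $A$, $N(A,\rho)$ is the least number of balls of radius $\rho$ required to cover $A$. $\mathcal{H}^{1}_{\infty}$ is the $1$-dimensional Hausdorff content, $\mathcal{H}^{1}_{\infty}(A) := \inf\{\sum_{i=1}^{\infty} \operatorname{diam}(E_{i}) : A \subset \bigcup_{i=1}^{\infty} E_{i}\}$. *)

(* Defs.v *)
From mathcomp Require Import all_boot all_order all_algebra.
From mathcomp Require Import all_classical all_reals all_analysis.

Set Implicit Arguments.
Unset Strict Implicit.
Unset Printing Implicit Defensive.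

Import Order.TTheory GRing.Theory Num.Theory.
Import numFieldNormedType.Exports.

Local Open Scope classical_set_scope.
Local Open Scope ring_scope.

(* The plane is ['rV[R]_2].  The library norm [`|x|] on row vectors is the sup
   norm, so the Euclidean structure is introduced explicitly; both norms induce
   the same topology, so [compact] is the usual compactness of the plane. *)

Definition dotp (R : realType) (x y : 'rV[R]_2) : R :=
  \sum_(i < 2) x 0 i * y 0 i.

Definition enorm (R : realType) (x : 'rV[R]_2) : R := Num.sqrt (dotp x x).

Definition eball (R : realType) (x : 'rV[R]_2) (rho : R) : set 'rV[R]_2 :=
  [set y | enorm (y - x) <= rho].

Definition unit_circle (R : realType) : set 'rV[R]_2 := [set e | enorm e = 1].
Arguments unit_circle : clear implicits.

(* Orthogonal projection onto the line spanned by [e] when [enorm e = 1]; only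
   used for such [e]. *)
Definition orthoproj (R : realType) (e x : 'rV[R]_2) : 'rV[R]_2 :=
  dotp x e *: e.

(* [covering_number A rho] is the least number of closed balls of radius [rho],
   with arbitrary centres in the plane, that cover [A].  It is an infimum of
   extended reals, hence [+oo] when no finite cover exists. *)
Definition covering_number (R : realType) (A : set 'rV[R]_2) (rho : R)
    : \bar R :=
  ereal_inf [set (n%:R)%:E | n in
    [set n : nat | exists x : 'I_n -> 'rV[R]_2,
       A `<=` \bigcup_i eball (x i) rho]].

(* The value 0 is adjoined so that the empty set has diameter 0, not [-oo]. *)
Definition diam (R : realType) (A : set 'rV[R]_2) : \bar R :=
  ereal_sup ([set 0%E] `|`
    [set d | exists x y, [/\ A x, A y & d = (enorm (x - y))%:E]]).

Definition hausdorff_content1 (R : realType) (A : set 'rV[R]_2) : \bar R :=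
  ereal_inf [set (\sum_(0 <= i <oo) diam (E i))%E | E in
    [set E : nat -> set 'rV[R]_2 | A `<=` \bigcup_i E i]].

Definition small_proj_dirs (R : realType) (K : set 'rV[R]_2) (delta t : R)
    : set 'rV[R]_2 :=
  [set e | unit_circle R e /\
     (covering_number (orthoproj e @` K) delta <= t%:E)%E].

(* Main.v *)
Require Import Defs.
From mathcomp Require Import all_boot all_order all_algebra.
From mathcomp Require Import all_classical all_reals all_analysis.
From mathcomp Require Import fintype finset.
From mathcomp Require Import ring lra zify.

(** Write [M] for [delta `^ (- s)]; note [M ^+ 2 * delta >= 1] because [s >= 1/2].

    Upper bound. The [1 / r] half of the minimum is the length of the circle.
    For the other half, take [N] directions that are [r]-separated and in which
    [K] has at most [M] intervals of length about [delta].  A discrete Frostman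
    lemma ([frostman_points]) replaces [K] by about [1 / delta] of its points,
    at most about [t / delta] of them in any ball of radius [t].  Each direction
    sorts these points into [O(M)] parallel tubes of width [2 delta], and the
    number of point-tube incidences calls for the Szemeredi-Trotter argument of
    Szekely: join consecutive points of a tube by a segment.  Two tubes of
    different directions meet in a slice of length [O(delta / r)].  So if
    segments shorter than a multiple of [delta / r] are discarded, then two
    tubes produce at most four crossings, there are [O(N ^+ 2 * M ^+ 2)]
    crossings in all, and no two directions give the same segment.  On the
    other hand a straight-line graph with [n] vertices and [E >= 8 n] edges has
    at least [E ^+ 3 / (128 n ^+ 2)] crossings ([crossing_lemma]); with
    [E >= N n / 2] this gives [N n = O(M ^+ 2)] ([incidence_bound]).

    Discarding short segments is harmless only if few pairs of points are close
    to each other in a common tube.  By the Frostman condition the expected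
    number of such pairs is small in a random subset of density
    [N r / log (1 / delta)], up to constants ([random_subset_few_close]); there
    [n] is about [N r / (delta log (1 / delta))], and [N n = O(M ^+ 2)] becomes
    [N = O(M (delta / r)^(1/2) log^(1/2) (1 / delta))].  If instead [n] is too
    small compared with the number of tubes, then
    [N = O(M (delta / r) log (1 / delta))] at once ([card_directions]).

    Sharpness.  Put [omega = M (delta r)^(1/2)].  Up to a dilation, [K] is made
    of vertical segments of length [delta / omega], over a grid of
    [omega ^+ 2 / delta] columns at distance [delta / omega] and [1 / omega] rows
    at distance [omega]; each row is sheared into a staircase, so that the heights
    of [K] fill an interval and its content is bounded below.  The directions
    orthogonal to lattice lines of slope [- p / q] in grid coordinates, with [p]
    up to [M omega] and [q] about [1 / (M r)], map the grid into [O(M)] points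
    ([staircase_small_proj]).  Those with [p] and [q] coprime are [r]-separated,
    and there are about [M (delta / r)^(1/2)] of them ([many_small_dirs]). *)

Set Implicit Arguments.
Unset Strict Implicit.
Unset Printing Implicit Defensive.

Import Order.TTheory GRing.Theory Num.Theory.
Import numFieldNormedType.Exports.
Local Open Scope ring_scope.

(** * A crossing inequality for straight-line graphs *)

(** An injection given only as a relation: the charges below are defined by
    existence statements rather than by functions. *)
Lemma leq_card_rel (K I : finType) (A : {set K}) (V : {set I}) (Q : K -> I -> Prop) :
  (forall g, g \in A -> exists2 v, v \in V & Q g v) ->
  (forall g h v, g \in A -> h \in A -> Q g v -> Q h v -> g = h) ->
  (#|A| <= #|V|)%N.
Proof.
move=> ex inj.
have [f fP] : exists f : K -> option I, forall g, g \in A ->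
    exists v, [/\ f g = Some v, v \in V & Q g v].
  suff: forall s : seq K, exists f : K -> option I, forall g, g \in s -> g \in A ->
    exists v, [/\ f g = Some v, v \in V & Q g v].
    move=> /(_ (enum K)) [f Hf]; exists f => g; apply: Hf; exact: mem_enum.
  elim=> [|k s [f Hf]]; first by exists (fun=> None).
  case: (boolP (k \in A)) => [kA|kA].
    have [v vV Qv] := ex _ kA.
    exists (fun g => if g == k then Some v else f g) => g.
    rewrite inE; case: eqP => [-> _ _|_ /= gs gA]; first by exists v.
    exact: Hf.
  exists f => g; rewrite inE => /orP[/eqP->|]; first by rewrite (negbTE kA).
  exact: Hf.
have finj : {in A &, injective f}.
  move=> g h gA hA e.
  have [v [fv _ Qv]] := fP _ gA; have [w [fw _ Qw]] := fP _ hA.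
  move: e; rewrite fv fw => -[e]; apply: (inj g h v) => //; by rewrite e.
rewrite -(card_in_imset finj) -(card_imset V (@Some_inj _)).
apply: subset_leq_card; apply/subsetP => o /imsetP[g gA ->].
have [v [-> vV _]] := fP _ gA; exact: imset_f.
Qed.

Section Planar.
Variables (R : realFieldType) (I K : finType) (x y : I -> R) (p q : K -> I).

(** The open segment; endpoints are excluded so that adjacent edges do not cross. *)
Definition on_seg (z w : R) (a b : I) :=
  exists t, [/\ 0 < t, t < 1, z = x a + t * (x b - x a) & w = y a + t * (y b - y a)].

Definition slope g := (y (q g) - y (p g)) / (x (q g) - x (p g)).
Definition height g u := y (p g) + slope g * (u - x (p g)).
Definition spans g u := x (p g) < u < x (q g).

(** Edges are indexed by an abstract type, so that parallel edges are allowed and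
    count as crossing. *)
Definition plane_graph (V : {set I}) (G : {set K}) :=
  [/\ {in V &, injective x},
      forall g, g \in G -> [/\ p g \in V, q g \in V & x (p g) < x (q g)] &
      forall g v, g \in G -> v \in V -> ~ on_seg (x v) (y v) (p g) (q g)].

Definition noncrossing (G : {set K}) :=
  forall g h z w, g \in G -> h \in G ->
    on_seg z w (p g) (q g) -> on_seg z w (p h) (q h) -> g = h.

Lemma height_p g : height g (x (p g)) = y (p g).
Proof. by rewrite /height subrr mulr0 addr0. Qed.

Lemma height_q g : x (p g) < x (q g) -> height g (x (q g)) = y (q g).
Proof.
move=> lt; rewrite /height /slope divfK ?subr_eq0 ?gt_eqF //; ring.
Qed.

Lemma on_segP g u w : x (p g) < x (q g) ->
  (on_seg u w (p g) (q g) <-> spans g u /\ w = height g u).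
Proof.
move=> lt; have d0 : 0 < x (q g) - x (p g) by rewrite subr_gt0.
have dn0 := lt0r_neq0 d0.
split=> [[t [t0 t1 -> ->]]|[/andP[lt1 lt2] ->]].
  split; last by rewrite /height /slope; field.
  by apply/andP; split; nra.
exists ((u - x (p g)) / (x (q g) - x (p g))); split.
- by rewrite divr_gt0 // subr_gt0.
- by rewrite ltr_pdivrMr // mul1r; lra.
- by field.
- by rewrite /height /slope; field.
Qed.

Section Graph.
Variables (V : {set I}) (G : {set K}).
Hypothesis pg : plane_graph V G.

Let xinj : {in V &, injective x}. Proof. by case: pg. Qed.
Let pV g : g \in G -> p g \in V. Proof. by case: pg => _ h _ /h[]. Qed.
Let qV g : g \in G -> q g \in V. Proof. by case: pg => _ h _ /h[]. Qed.
Let xpq g : g \in G -> x (p g) < x (q g). Proof. by case: pg => _ h _ /h[]. Qed.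

Lemma vertex_off_edge g v : g \in G -> v \in V -> spans g (x v) -> height g (x v) != y v.
Proof.
move=> gG vV sp; apply/eqP => e; case: pg => _ _ /(_ _ _ gG vV); apply.
by apply/(on_segP _ _ (xpq gG)).
Qed.

(** Otherwise the shorter of the two edges would end inside the longer one. *)
Lemma same_start g h : g \in G -> h \in G -> p g = p h -> slope g = slope h ->
  q g = q h.
Proof.
move=> gG hG epp es.
have key k l : k \in G -> l \in G -> p k = p l -> slope k = slope l ->
    ~ (x (q k) < x (q l)).
  move=> kG lG ep esl lt.
  have sp : spans l (x (q k)) by rewrite /spans -ep xpq.
  move/eqP: (vertex_off_edge lG (qV kG) sp); apply.
  by rewrite -(height_q (xpq kG)) /height ep esl.
apply: xinj; rewrite ?qV //; apply/eqP; rewrite eq_le !leNgt.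
by apply/andP; split; apply/negP; apply: key.
Qed.

Lemma same_end g h : g \in G -> h \in G -> q g = q h -> slope g = slope h ->
  p g = p h.
Proof.
move=> gG hG eqq es.
have hE k u : k \in G -> height k u = y (q k) + slope k * (u - x (q k)).
  by move=> kG; rewrite -(height_q (xpq kG)) /height; ring.
have key k l : k \in G -> l \in G -> q k = q l -> slope k = slope l ->
    ~ (x (p k) < x (p l)).
  move=> kG lG ep esl lt.
  have sp : spans k (x (p l)) by rewrite /spans ep xpq // lt.
  move/eqP: (vertex_off_edge kG (pV lG) sp); apply.
  by rewrite -(height_p l) !hE // ep esl.
apply: xinj; rewrite ?pV //; apply/eqP; rewrite eq_le !leNgt.
by apply/andP; split; apply/negP; apply: key.
Qed.

Section NonCrossing.
Hypothesis nc : noncrossing G.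

Lemma height_inj g h u : g \in G -> h \in G -> spans g u -> spans h u ->
  height g u = height h u -> g = h.
Proof.
move=> gG hG sg sh e; apply: (nc (z := u) (w := height g u)) => //;
  by apply/on_segP; rewrite ?xpq.
Qed.

(** Intermediate value theorem for the affine function [height g - height h]. *)
Lemma no_swap g h u v : g \in G -> h \in G -> u < v ->
  x (p g) <= u -> x (p h) <= u -> v <= x (q g) -> v <= x (q h) ->
  height g u < height h u -> height h v < height g v -> False.
Proof.
move=> gG hG uv pgu phu vqg vqh lt1 lt2.
pose a := height h u - height g u; pose b := height g v - height h v.
have a0 : 0 < a by rewrite subr_gt0.
have b0 : 0 < b by rewrite subr_gt0.
pose w := u + (v - u) * (a / (a + b)).
have ab0 : 0 < a + b by rewrite addr_gt0.
have f0 : 0 < a / (a + b) by rewrite divr_gt0.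
have f1 : a / (a + b) < 1 by rewrite ltr_pdivrMr //; lra.
have uw : u < w by rewrite /w; nra.
have wv : w < v by rewrite /w; nra.
have e : height g w = height h w.
  have abn0 : (height h u - height g u) + (height g v - height h v) != 0 by exact: lt0r_neq0.
  rewrite /w /a /b; move: abn0; rewrite /height; set sg := slope g; set sh := slope h => abn0.
  by field.
have eg : g = h.
  apply: (@height_inj _ _ w) => //; apply/andP; split; lra.
by move: lt1; rewrite eg ltxx.
Qed.

(** The edge that follows [g] when the edges leaving [p g] are turned upwards. *)
Definition next g h := [/\ h \in G, p h = p g, slope g < slope h &
  forall k, k \in G -> p k = p g -> slope g < slope k -> slope h <= slope k].

Lemma next_exists g k0 : k0 \in G -> p k0 = p g -> slope g < slope k0 ->
  exists h, next g h.
Proof.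
move=> k0G pk0 sk0.
pose P k := [&& k \in G, p k == p g & slope g < slope k].
have P0 : P k0 by rewrite /P k0G pk0 eqxx.
case: (arg_minP slope P0) => h /and3P[hG /eqP ph sh] hmin.
exists h; split=> // k kG pk sk; apply: hmin; by rewrite /P kG pk eqxx.
Qed.

Lemma height_same_start g h u : p g = p h -> x (p g) < u ->
  (height g u < height h u) = (slope g < slope h).
Proof.
by move=> e lt; rewrite /height -e ltrD2l ltr_pM2r // subr_gt0.
Qed.

Definition in_wedge g h v := [/\ v \in V, spans g (x v), spans h (x v),
  height g (x v) < y v & y v < height h (x v)].

Lemma off_wedge g h v : g \in G -> h \in G -> v \in V ->
  spans g (x v) -> spans h (x v) -> ~ in_wedge g h v ->
  y v < height g (x v) \/ height h (x v) < y v.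
Proof.
move=> gG hG vV sg sh nw.
have /eqP n1 := vertex_off_edge gG vV sg; have /eqP n2 := vertex_off_edge hG vV sh.
case: (ltgtP (y v) (height g (x v))) => [|gv|e]; [by left| |by case: n1].
case: (ltgtP (y v) (height h (x v))) => [vh||e]; [|by right|by case: n2].
by case: nw; split.
Qed.

(** An edge between [g] and the leftmost vertex [v] of the wedge would have to enter
    the wedge from the left of [v], hence through a vertex of the wedge, through
    its apex or through one of its sides. *)
Lemma leftmost_below g h v k : g \in G -> next g h -> in_wedge g h v ->
  (forall w, in_wedge g h w -> x v <= x w) ->
  k \in G -> spans k (x v) -> height k (x v) < y v -> 
  height k (x v) <= height g (x v).
Proof.
move=> gG nx [vV sg sh gv vh] vmin kG sk kv; rewrite leNgt; apply/negP => gk.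
have [hG ph sgh hmin] := nx.
have [/andP[pgv vqg] /andP[phv vqh] /andP[pkv vqk]] := And3 sg sh sk.
have kh : height k (x v) < height h (x v) by exact: lt_trans vh.
case: (ltgtP (x (p k)) (x (p g))) => [lt|gt|e].
- have spk : spans k (x (p g)) by rewrite /spans lt; apply: lt_trans vqk.
  have /eqP ne := vertex_off_edge kG (pV gG) spk.
  case: (ltgtP (height k (x (p g))) (y (p g))) => [below|above|//].
    apply: (@no_swap k g (x (p g)) (x v)) => //; rewrite ?height_p //; exact: ltW.
  apply: (@no_swap h k (x (p g)) (x v)) => //; rewrite ?ph //; try exact: ltW.
  by rewrite -ph height_p ph.
- have sgk : spans g (x (p k)) by rewrite /spans gt /=; apply: lt_trans vqg.
  have shk : spans h (x (p k)) by rewrite /spans ph gt /=; apply: lt_trans vqh.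
  have nw : ~ in_wedge g h (p k) by move=> /vmin; rewrite leNgt pkv.
  have [below|above] := off_wedge gG hG (pV kG) sgk shk nw.
  + apply: (@no_swap k g (x (p k)) (x v)) => //; rewrite ?height_p //; exact: ltW.
  + apply: (@no_swap h k (x (p k)) (x v)) => //; rewrite ?height_p ?ph //; exact: ltW.
- have epk : p k = p g by apply: xinj; rewrite ?pV.
  have s1 : slope g < slope k by rewrite -(@height_same_start g k (x v)).
  have s2 : slope k < slope h by rewrite -(@height_same_start k h (x v)) // epk.
  by move: (hmin _ kG epk s1); rewrite leNgt s2.
Qed.

Lemma height_same_end g h u : g \in G -> h \in G -> q g = q h -> u < x (q g) ->
  (height g u < height h u) = (slope h < slope g).
Proof.
move=> gG hG e lt.
have hE k : k \in G -> height k u = y (q k) - slope k * (x (q k) - u).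
  by move=> kG; rewrite -(height_q (xpq kG)) /height; ring.
by rewrite !hE // -e ltrD2l ltrN2 ltr_pM2r // subr_gt0.
Qed.

(** An edge arriving at [q g] above [g] runs inside the wedge near [q g], and an
    empty wedge leaves it no place to come from. *)
Lemma empty_wedge_lower g h k : g \in G -> next g h ->
  (forall w, ~ in_wedge g h w) -> x (q g) < x (q h) ->
  k \in G -> q k = q g -> slope g <= slope k.
Proof.
move=> gG nx emp lt kG qk; rewrite leNgt; apply/negP => slt.
have [hG ph sgh hmin] := nx.
have gq : height g (x (q g)) < height h (x (q g)).
  by rewrite height_same_start ?ph ?xpq.
case: (ltgtP (x (p k)) (x (p g))) => [pl|gt|e].
- have ab : height g (x (p g)) < height k (x (p g)).
    by rewrite height_same_end ?xpq.
  apply: (@no_swap h k (x (p g)) (x (q g))) => //; rewrite ?ph ?xpq ?qk //; try exact: ltW.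
    by rewrite -{1}ph height_p ph -(height_p g).
  by rewrite -{1}qk (height_q (xpq kG)) qk -(height_q (xpq gG)).
- have sgk : spans g (x (p k)) by rewrite /spans gt /= -qk xpq.
  have shk : spans h (x (p k)).
    by rewrite /spans ph gt /=; apply: lt_trans lt; rewrite -qk xpq.
  have [below|above] := off_wedge gG hG (pV kG) sgk shk (emp _).
  + have : height g (x (p k)) < height k (x (p k)).
      by rewrite height_same_end // -qk xpq.
    by rewrite height_p ltNge (ltW below).
  + apply: (@no_swap h k (x (p k)) (x (q g))) => //; rewrite ?height_p ?ph ?qk //; try exact: ltW.
      by rewrite -qk xpq.
    by rewrite -{1}qk (height_q (xpq kG)) qk -(height_q (xpq gG)).
- have epk : p k = p g by apply: xinj; rewrite ?pV.
  have := height_same_start epk (u := x (q g)); rewrite e xpq // => /(_ isT).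
  rewrite slt -{1}qk (height_q (xpq kG)) qk -(height_q (xpq gG)) ltxx.
  by [].
Qed.

Lemma empty_wedge_upper g h k : g \in G -> next g h ->
  (forall w, ~ in_wedge g h w) -> x (q h) < x (q g) ->
  k \in G -> q k = q h -> slope k <= slope h.
Proof.
move=> gG nx emp lt kG qk; rewrite leNgt; apply/negP => slt.
have [hG ph sgh hmin] := nx.
have gq : height g (x (q h)) < height h (x (q h)).
  by rewrite height_same_start ?ph // -ph xpq.
case: (ltgtP (x (p k)) (x (p g))) => [pl|gt|e].
- have ab : height k (x (p g)) < height h (x (p g)).
    by rewrite height_same_end ?qk // -ph xpq.
  apply: (@no_swap k g (x (p g)) (x (q h))) => //; rewrite ?qk //; try exact: ltW.
  - by rewrite -ph xpq.
  - by move: ab; rewrite -{2}ph height_p ph height_p.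
  by rewrite -{2}qk (height_q (xpq kG)) qk -(height_q (xpq hG)).
- have shk : spans h (x (p k)) by rewrite /spans ph gt /= -qk xpq.
  have sgk : spans g (x (p k)).
    by rewrite /spans gt /=; apply: lt_trans lt; rewrite -qk xpq.
  have [below|above] := off_wedge gG hG (pV kG) sgk shk (emp _).
  + apply: (@no_swap k g (x (p k)) (x (q h))) => //; rewrite ?height_p ?qk //; try exact: ltW.
      by rewrite -qk xpq.
    by rewrite -{2}qk (height_q (xpq kG)) qk -(height_q (xpq hG)).
  + have : height k (x (p k)) < height h (x (p k)).
      by rewrite height_same_end // xpq.
    by rewrite height_p ltNge (ltW above).
- have epk : p h = p k by apply: xinj; rewrite ?pV // ph e.
  have := height_same_start epk (u := x (q h)); rewrite xpq // => /(_ isT).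
  rewrite slt -{2}qk (height_q (xpq kG)) qk -(height_q (xpq hG)) ltxx.
  by [].
Qed.

Definition top_at_start g v := v = p g /\
  forall h, h \in G -> p h = p g -> slope h <= slope g.
Definition top_at_end g v := v = q g /\
  forall k, k \in G -> q k = q g -> slope g <= slope k.
Definition next_bottom_at_end g v := exists h, [/\ next g h, q h = v &
  forall k, k \in G -> q k = q h -> slope k <= slope h].
Definition just_below g v := [/\ spans g (x v), height g (x v) < y v &
  forall k, k \in G -> spans k (x v) -> height k (x v) < y v ->
    height k (x v) <= height g (x v)].

(** Every edge is charged to a vertex in one of four ways, each of which charges a
    vertex at most once.  If [g] is not the topmost edge at its left end, let [h]
    follow it.  Either the wedge between them contains a vertex, and [g] is the
    edge just below the leftmost one; or the wedge is empty, and the edge that ends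
    first is extremal at its right end. *)
Lemma edge_charged g : g \in G -> exists2 v, v \in V &
  [\/ top_at_start g v, top_at_end g v, next_bottom_at_end g v | just_below g v].
Proof.
move=> gG.
have [[k0 [k0G pk0 sk0]]|none] :=
    pselect (exists k, [/\ k \in G, p k = p g & slope g < slope k]); last first.
  exists (p g); first exact: pV.
  apply: Or41; split=> // h hG ph; rewrite leNgt; apply/negP => lt.
  by apply: none; exists h.
have [h nx] := next_exists k0G pk0 sk0.
have [hG ph sgh _] := nx.
have [[v0 v0in]|emp] := pselect (exists v, in_wedge g h v).
  pose P v := `[<in_wedge g h v>].
  have P0 : P v0 by apply/asboolP.
  case: (arg_minP x P0) => v /asboolP vin vmin.
  have [vV sg _ gv _] := vin; exists v => //; apply: Or44; split=> // k.
  apply: (@leftmost_below g h v) => // w win; apply: vmin; exact/asboolP.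
have emp' w : ~ in_wedge g h w by move=> win; apply: emp; exists w.
case: (ltgtP (x (q g)) (x (q h))) => [lt|gt|e].
- exists (q g); first exact: qV.
  by apply: Or42; split=> // k; apply: (empty_wedge_lower gG nx).
- exists (q h); first exact: qV.
  by apply: Or43; exists h; split=> // k; apply: (empty_wedge_upper gG nx).
- have eq_q : q g = q h by apply: xinj; rewrite ?qV.
  by move: sgh; rewrite /slope ph eq_q ltxx.
Qed.

Lemma edge_eq g h : g \in G -> h \in G -> p g = p h -> slope g = slope h -> g = h.
Proof.
move=> gG hG ep es; have eq_q := same_start gG hG ep es.
have lt := xpq gG.
pose u := (x (p g) + x (q g)) / 2%:R.
have su : spans g u by rewrite /spans /u; apply/andP; split; lra.
apply: (@height_inj g h u) => //; first by rewrite /spans -ep -eq_q.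
by rewrite /height ep es.
Qed.

(** A linear bound that replaces Euler's formula; the constant is not optimal. *)
Lemma card_noncrossing : (#|G| <= 4 * #|V|)%N.
Proof.
pose A (Q : K -> I -> Prop) := [set g in G | `[<exists2 v, v \in V & Q g v>]].
have cA Q : (forall g h v, g \in G -> h \in G -> Q g v -> Q h v -> g = h) ->
    (#|A Q| <= #|V|)%N.
  move=> inj; apply: (leq_card_rel (Q := Q)) => [g|g h v].
    by rewrite inE => /andP[_ /asboolP].
  by rewrite !inE => /andP[gG _] /andP[hG _]; apply: inj.
have sub : G \subset A top_at_start :|: A top_at_end :|:
    (A next_bottom_at_end :|: A just_below).
  apply/subsetP => g gG; have [v vV c] := edge_charged gG.
  rewrite !inE gG /=; case: c => c.
  - by apply/orP; left; apply/orP; left; apply/asboolP; exists v.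
  - by apply/orP; left; apply/orP; right; apply/asboolP; exists v.
  - by apply/orP; right; apply/orP; left; apply/asboolP; exists v.
  - by apply/orP; right; apply/orP; right; apply/asboolP; exists v.
apply: leq_trans (subset_leq_card sub) _.
apply: leq_trans (leq_card_setU _ _) _.
apply: leq_trans (leq_add (leq_card_setU _ _) (leq_card_setU _ _)) _.
rewrite (_ : 4 * #|V| = #|V| + #|V| + (#|V| + #|V|))%N; last first.
  by rewrite !addnn -!mul2n mulnA.
apply: leq_add; apply: leq_add; apply: cA => g h v gG hG.
- case=> -> tg [ep th]; apply: edge_eq => //; apply/eqP.
  by rewrite eq_le tg ?th.
- case=> -> tg [eq_q th].
  have es : slope g = slope h by apply/eqP; rewrite eq_le tg ?th.
  exact: edge_eq (same_end gG hG eq_q es) es.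
- case=> g1 [[g1G pg1 sg1 mg1] qg1 tg1] [h1 [[h1G ph1 sh1 mh1] qh1 th1]].
  have eq_q : q g1 = q h1 by rewrite qg1.
  have es : slope g1 = slope h1 by apply/eqP; rewrite eq_le tg1 ?th1.
  have e1 : g1 = h1 := edge_eq g1G h1G (same_end g1G h1G eq_q es) es.
  have ep : p g = p h by rewrite -pg1 e1.
  apply: edge_eq => //; case: (ltgtP (slope g) (slope h)) => // lt.
    by move: (mg1 _ hG (esym ep) lt); rewrite e1 leNgt sh1.
  by move: (mh1 _ gG ep lt); rewrite -e1 leNgt sg1.
- case=> sg bg mg [sh bh mh]; apply: (@height_inj g h (x v)) => //.
  by apply/eqP; rewrite eq_le mg ?mh.
Qed.

End NonCrossing.
End Graph.

Definition crossing g h :=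
  `[<exists z w, on_seg z w (p g) (q g) /\ on_seg z w (p h) (q h)>].

Definition crossings (G : {set K}) : {set K * K} :=
  [set gh in setX G G | (gh.1 != gh.2) && crossing gh.1 gh.2].

Lemma plane_graph_sub (V W : {set I}) (G H : {set K}) :
  plane_graph V G -> W \subset V -> H \subset G ->
  (forall g, g \in H -> p g \in W /\ q g \in W) -> plane_graph W H.
Proof.
move=> [xi ed off] /subsetP WV /subsetP HG HW; split.
- by move=> u v /WV uV /WV vV; apply: xi.
- by move=> g gH; have [_ _ lt] := ed _ (HG _ gH); have [] := HW _ gH.
- by move=> g v /HG gG /WV vV; apply: off.
Qed.

(** Delete one edge from each crossing pair. *)
Lemma card_le_crossings (V : {set I}) (G : {set K}) : plane_graph V G ->
  (#|G| <= 4 * #|V| + #|crossings G|)%N.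
Proof.
have [n] := ubnP #|G|; elim: n G => // n IH G; rewrite ltnS => Gn pgG.
have [/existsP[gh ghX]|/pred0Pn empty] := boolP [exists gh, gh \in crossings G]; last first.
  apply: leq_trans (leq_addr _ _); apply: (card_noncrossing pgG) => g h z w gG hG sg sh.
  apply/eqP; apply/negPn/negP => ne; apply: empty; exists (g, h).
  by rewrite !inE gG hG ne; apply/asboolP; exists z, w.
have gG : gh.1 \in G by move: ghX; rewrite !inE => /andP[/andP[]].
have sub : crossings (G :\ gh.1) \subset crossings G :\ gh.
  apply/subsetP => kl; rewrite !inE; case/andP => /andP[/andP[k1 ->] /andP[_ ->]] ->.
  rewrite !andbT; apply/eqP => e; by rewrite e eqxx in k1.
have Hlt : (#|G :\ gh.1| < n)%N.
  by move: Gn; rewrite (cardsD1 gh.1 G) gG.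
have HG : plane_graph V (G :\ gh.1).
  apply: (plane_graph_sub pgG) => //; first exact: subsetDl.
  by move=> g /setD1P[_ gG']; case: pgG => _ /(_ _ gG')[].
have := IH _ Hlt HG; rewrite (cardsD1 gh.1 G) gG (cardsD1 gh (crossings G)) ghX.
rewrite add1n addnCA add1n ltnS => /leq_trans; apply.
by rewrite leq_add2l; exact: subset_leq_card.
Qed.
End Planar.

Section RandomSubset.
Variables (R : realFieldType) (I : finType) (t : R).
Hypotheses (t0 : 0 <= t) (t1 : t <= 1).

(** The probability of [A] when each element is kept independently with
    probability [t]. *)
Definition weight (A : {set I}) : R := \prod_i (if i \in A then t else 1 - t).

Lemma weight_ge0 A : 0 <= weight A.
Proof. by apply: prodr_ge0 => i _; case: ifP => _ //; rewrite subr_ge0. Qed.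

(** Expand the product of [t + (1 - t)], where the second term is replaced by [0]
    at the elements of [S]. *)
Lemma sum_weight_sup (S : {set I}) : \sum_(A : {set I} | S \subset A) weight A = t ^+ #|S|.
Proof.
transitivity (\sum_(A : {set I}) \prod_i
    (if i \in A then t else if i \in S then 0 else 1 - t)).
  rewrite [RHS](bigID (fun A : {set I} => S \subset A)) /= [X in _ = _ + X]big1 ?addr0.
    apply: eq_bigr => A /subsetP SA; apply: eq_bigr => i _.
    case: (boolP (i \in A)) => // iA; case: ifP => // /SA; by rewrite (negbTE iA).
  move=> A /subsetPn[i iS iA]; rewrite (bigD1 i) //= (negbTE iA) iS mul0r //.
rewrite -bigA_distr (bigID (mem S)) /= [X in _ * X]big1 ?mulr1.
  by rewrite (eq_bigr (fun=> t)) ?prodr_const // => i /= ->; rewrite addr0.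
by move=> i /= /negbTE ->; rewrite addrC subrK.
Qed.

Lemma sum_weight : \sum_(A : {set I}) weight A = 1.
Proof.
have := sum_weight_sup set0; rewrite cards0 expr0 => <-.
by apply: eq_bigl => A; rewrite sub0set.
Qed.

Lemma expect_count (J : finType) (P : {set J}) (S : J -> {set I}) k :
  (forall j, j \in P -> #|S j| = k) ->
  \sum_(A : {set I}) weight A * #|[set j in P | S j \subset A]|%:R = t ^+ k * #|P|%:R.
Proof.
move=> Sk.
transitivity (\sum_(A : {set I}) \sum_(j in P) (if S j \subset A then weight A else 0)).
  apply: eq_bigr => A _; rewrite -big_mkcondr /= sumr_const mulr_natr; congr (_ *+ _).
  by apply: eq_card => j; rewrite !inE.
rewrite exchange_big /= (eq_bigr (fun=> t ^+ k)) ?sumr_const ?mulr_natr // => j jP.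
by rewrite -big_mkcond /= sum_weight_sup Sk.
Qed.

Lemma exists_ge_expect (f : {set I} -> R) c :
  c <= \sum_(A : {set I}) weight A * f A -> exists A, c <= f A.
Proof.
move=> le; have [[A hA]|no] := pselect (exists A, c <= f A); first by exists A.
exfalso; move: le; apply/negP; rewrite -ltNge.
have lt A : f A < c by rewrite ltNge; apply/negP => h; apply: no; exists A.
have -> : c = \sum_(A : {set I}) weight A * c.
  by rewrite -mulr_suml sum_weight mul1r.
have [A wA] : exists A, 0 < weight A.
  have [[A]|n] := pselect (exists A, 0 < weight A); first by exists A.
  have : \sum_(A : {set I}) weight A = 0.
    apply: big1 => A _; apply/eqP; rewrite eq_le weight_ge0 andbT leNgt.
    by apply/negP => h; apply: n; exists A.
  by rewrite sum_weight => /eqP; rewrite oner_eq0.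
rewrite (bigD1 A) //= [ltRHS](bigD1 A) //=; apply: ltr_leD.
  by rewrite ltr_pM2l.
by apply: ler_sum => B _; apply: ler_wpM2l; [exact: weight_ge0|exact: ltW].
Qed.
End RandomSubset.

Section CrossingLemma.
Variables (R : realFieldType) (I K : finType) (x y : I -> R) (p q : K -> I).
Variables (V : {set I}) (G : {set K}).
Hypothesis pg : plane_graph x y p q V G.
Hypothesis simple : {in G &, forall g h, p g = p h -> q g = q h -> g = h}.

Let quad (gh : K * K) := [set p gh.1; q gh.1] :|: [set p gh.2; q gh.2].

Lemma card_ends g : g \in G -> #|[set p g; q g]| = 2%N.
Proof.
case: pg => _ ed _ /ed[_ _ lt]; rewrite cards2.
by case: eqP lt => // ->; rewrite ltxx.
Qed.

(** Crossing edges share no endpoint: two edges with a common end and a common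
    interior point overlap, and then one ends inside the other.  Hence a crossing
    survives in a random subset of the vertices with probability [t ^+ 4]. *)
Lemma card_quad gh : gh \in crossings x y p q G -> #|quad gh| = 4%N.
Proof.
case: gh => g h; rewrite !inE /= => /andP[/andP[gG hG] /andP[ne]].
move=> /asboolP[z [w [sg sh]]].
have [xinj ed _] := pg; have [pgV qgV ltg] := ed _ gG; have [phV qhV lth] := ed _ hG.
move: sg sh => /(on_segP _ _ _ ltg)[spg ->] /(on_segP _ _ _ lth)[sph e].
have npp : p g <> p h.
  move=> epp; have es : slope x y p q g = slope x y p q h.
    move: e; rewrite /height epp; move=> /addrI /mulIf; apply.
    by rewrite subr_eq0 gt_eqF //; case/andP: sph.
  by move/eqP: ne; apply; apply: simple => //; exact: (same_start pg gG hG).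
have nqq : q g <> q h.
  move=> eqq; have es : slope x y p q g = slope x y p q h.
    have hE k u : x (p k) < x (q k) ->
        height x y p q k u = y (q k) + slope x y p q k * (u - x (q k)).
      by move=> lt; rewrite -(@height_q _ _ _ x y p q k lt) /height; ring.
    move: e; rewrite !hE // eqq; move=> /addrI /mulIf; apply.
    by rewrite subr_eq0 lt_eqF //; case/andP: sph.
  move/eqP: ne; apply; apply: simple => //; exact: (same_end pg gG hG).
have npq : p g <> q h.
  move=> epq; move: spg sph; rewrite /spans epq => /andP[l1 _] /andP[_ l2].
  by move: (lt_trans l1 l2); rewrite ltxx.
have nqp : q g <> p h.
  move=> epq; move: spg sph; rewrite /spans epq => /andP[_ l1] /andP[l2 _].
  by move: (lt_trans l1 l2); rewrite ltxx.
rewrite /quad cardsU !card_ends //=.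
suff -> : [set p g; q g] :&: [set p h; q h] = set0 by rewrite cards0.
apply/setP => i; rewrite !inE; apply/negbTE/negP => /andP[].
by case/orP=> /eqP ->; case/orP => /eqP.
Qed.

(** Expectation of [card_le_crossings] over a random subset of the vertices. *)
Lemma sampled_crossing_bound t : 0 <= t -> t <= 1 ->
  t ^+ 2 * #|G|%:R <= t * (4%:R * #|V|%:R) + t ^+ 4 * #|crossings x y p q G|%:R :> R.
Proof.
move=> t0 t1.
have E2 := expect_count t (J := K) (P := G) (S := fun g => [set p g; q g]) card_ends.
have E1 := expect_count t (J := I) (P := V) (S := fun v => [set v]) (k := 1)
  (fun v _ => cards1 v).
have E4 := expect_count t (J := (K * K)%type) (S := quad) card_quad.
rewrite -E2 -E4 mulrCA -{1}[t]expr1 -E1 mulr_sumr -big_split /=.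
apply: ler_sum => A _; rewrite mulrCA -mulrDr.
apply: ler_wpM2l; first exact: weight_ge0.
rewrite -natrM -natrD ler_nat.
set GA := [set g in G | _]; set VA := [set v in V | _]; set XA := [set gh in _ | _].
have pgA : plane_graph x y p q VA GA.
  apply: (plane_graph_sub pg); first by apply/subsetP => v; rewrite inE => /andP[].
    by apply/subsetP => v; rewrite inE => /andP[].
  move=> g; rewrite inE => /andP[gG]; rewrite subUset !sub1set => /andP[pA qA].
  by rewrite !inE !sub1set pA qA !andbT; case: pg => _ /(_ _ gG)[].
apply: leq_trans (card_le_crossings pgA) _; rewrite leq_add2l.
apply: subset_leq_card; apply/subsetP => -[g h]; rewrite !inE /=.
case/andP => /andP[/andP[-> sg] /andP[-> sh]] ->.
by rewrite /= /quad subUset sg sh.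
Qed.

(** The density [8 #|V| / #|G|] balances the two sides of
    [sampled_crossing_bound]. *)
Theorem crossing_lemma : (8 * #|V| <= #|G|)%N ->
  (#|G| ^ 3 <= 128 * #|V| ^ 2 * #|crossings x y p q G|)%N.
Proof.
move=> le8; have [G0|[g gG]] := set_0Vmem G; first by rewrite G0 cards0.
have Vpos : (0 < #|V|)%N.
  by apply/card_gt0P; exists (p g); case: pg => _ /(_ _ gG)[].
have Gpos : (0 < #|G|)%N by apply/card_gt0P; exists g.
rewrite -(ler_nat R) natrX (natrM _ (128 * _)) (natrM _ 128) natrX.
set X := #|crossings _ _ _ _ _|%:R.
have := @sampled_crossing_bound (8%:R * #|V|%:R / #|G|%:R).
have : (8%:R * #|V|%:R : R) <= #|G|%:R by rewrite -natrM ler_nat.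
have v0 : 0 < #|V|%:R :> R by rewrite ltr0n.
have g0 : 0 < #|G|%:R :> R by rewrite ltr0n.
rewrite -/X; move: (#|V|%:R : R) (#|G|%:R : R) X v0 g0 => v e X v0 e0 le.
have t0 : 0 <= 8%:R * v / e by rewrite divr_ge0 ?mulr_ge0 ?ltW.
have t1 : 8%:R * v / e <= 1 by rewrite ler_pdivrMr ?mul1r.
move=> /(_ t0 t1).
have en : e != 0 by exact: lt0r_neq0.
have -> : (8%:R * v / e) ^+ 2 * e = (e ^+ 3 * (64%:R * v ^+ 2)) / e ^+ 4 by field.
have -> : 8%:R * v / e * (4%:R * v) + (8%:R * v / e) ^+ 4 * X
   = (e ^+ 3 * (32%:R * v ^+ 2) + 4096%:R * v ^+ 4 * X) / e ^+ 4 by field.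
rewrite ler_pM2r ?invr_gt0 ?exprn_gt0 // => H.
have v2 : 0 < v ^+ 2 by rewrite exprn_gt0.
rewrite -(ler_pM2r (_ : 0 < 32%:R * v ^+ 2)); last by rewrite mulr_gt0.
lra.
Qed.
End CrossingLemma.

(** * Tubes in many directions through a finite set of points *)

(** Only finitely many shears align two of the points; any larger one works. *)
Lemma generic_shear (R : realFieldType) (I : finType) (x y : I -> R) :
  (forall i k, x i = x k -> y i = y k -> i = k) ->
  exists T, injective (fun i => x i + T * y i).
Proof.
move=> inj.
(* The bad shears: [F (i, k)] is the absolute value of the one that aligns [i] and [k]. *)
pose F (ik : I * I) : R := `|(x ik.1 - x ik.2) / (y ik.2 - y ik.1)|.
exists (1 + \sum_ik F ik) => i k /= e.
have eT : (1 + \sum_ik F ik) * (y k - y i) = x i - x k by lra.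
case: (eqVneq (y i) (y k)) => [ey|ny].
  apply: inj => //; move: eT; rewrite ey subrr mulr0; lra.
have d0 : y k - y i != 0 by rewrite subr_eq0 eq_sym.
have eF : F (i, k) = 1 + \sum_ik F ik.
  rewrite {1}/F /= -eT mulfK // ger0_norm // addr_ge0 // sumr_ge0 // => ik _.
  exact: normr_ge0.
move: eF; rewrite (bigD1 (i, k)) //=.
set S := bigop.body _ _ _; have S0 : 0 <= S by apply: sumr_ge0 => ik _; exact: normr_ge0.
rewrite addrCA -[LHS]addr0 => /addrI e0.
by have := ltr_pwDl (@ltr01 R) S0; rewrite -e0 ltxx.
Qed.

Section Incidence.
Variables (R : archiRealFieldType) (I J : finType).
Variables (x y : I -> R) (c s phi : J -> R) (delta r : R) (B : nat) (b : J -> I -> 'I_B).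

(** For unit vectors, the sine of the angle from direction [j] to direction [j']. *)
Definition det j j' := c j * s j' - s j * c j'.
Definition proj j i := c j * x i + s j * y i.
(** The coordinate along the tubes of direction [j]; [proj] is the coordinate
    across them. *)
Definition tau j i := - s j * x i + c j * y i.
Definition bucket j i := Num.floor (proj j i / (2 * delta)).
(** Two tubes meet in a slice of length at most [16 delta / r], as the sine
    of their angle is at least [r / 2] by [det_gt]; an edge must be longer. *)
Definition min_length := 17 * delta / r.

Hypothesis unit_dir : forall j, c j ^+ 2 + s j ^+ 2 = 1.
Hypothesis delta0 : 0 < delta.
Hypothesis r0 : 0 < r.
Hypothesis phi_sep : forall j j', j != j' -> r < `|phi j - phi j'|.
Hypothesis phi_lip : forall j j', `|phi j - phi j'| <= 2 * `|det j j'|.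
Hypothesis pos_inj : forall i k, x i = x k -> y i = y k -> i = k.
Hypothesis bP : forall j i k, b j i = b j k <-> bucket j i = bucket j k.

Lemma bucket_bounds j i :
  2 * delta * (bucket j i)%:~R <= proj j i < 2 * delta * (bucket j i)%:~R + 2 * delta.
Proof.
have d0 : 0 < 2 * delta by rewrite mulr_gt0.
have := floor_itv (proj j i / (2 * delta)); rewrite -/(bucket j i) intrD.
rewrite ler_pdivlMr // ltr_pdivrMr // => /andP[h1 h2].
apply/andP; split; lra.
Qed.

Lemma det_gt j j' : j != j' -> r / 2 < `|det j j'|.
Proof. by move=> /phi_sep; have := phi_lip j j'; lra. Qed.

Lemma dot_le1 j j' : `|c j * c j' + s j * s j'| <= 1.
Proof.
have := unit_dir j; have := unit_dir j' => e e'.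
rewrite ler_norml; apply/andP; split.
  have := sqr_ge0 (c j + c j'); have := sqr_ge0 (s j + s j'); nra.
have := sqr_ge0 (c j - c j'); have := sqr_ge0 (s j - s j'); nra.
Qed.

Lemma rotate_coord j j' (u v : R) :
  c j' * u + s j' * v = (c j * c j' + s j * s j') * (c j * u + s j * v)
    + det j j' * (- s j * u + c j * v).
Proof.
rewrite /det; have e := unit_dir j.
transitivity ((c j ^+ 2 + s j ^+ 2) * (c j' * u + s j' * v)); first by rewrite e mul1r.
ring.
Qed.

Lemma min_length_gt0 : 0 < min_length.
Proof. by rewrite /min_length divr_gt0 // mulr_gt0. Qed.

Variable V : {set I}.

Definition later j i k := [&& k \in V, b j k == b j i & tau j i < tau j k].
Definition close_in_tube j i k := [&& i != k, b j i == b j k & `|tau j i - tau j k| < min_length].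
Definition nxt j i := odflt i [pick k | later j i k && [forall l, later j i l ==> (tau j k <= tau j l)]].
(** The pair [(j, i)] stands for the segment from [i] to the next point of its tube
    in direction [j].  Points with a companion in the same tube, at distance less than
    [min_length] along it, start no edge; this also removes ties in the order along a tube. *)
Definition edges : {set J * I} :=
  [set g | [&& g.2 \in V, ~~ [exists k in V, close_in_tube g.1 g.2 k] & [exists k, later g.1 g.2 k]]].

Lemma nxtP g : g \in edges ->
  later g.1 g.2 (nxt g.1 g.2) /\ (forall l, later g.1 g.2 l -> tau g.1 (nxt g.1 g.2) <= tau g.1 l).
Proof.
case: g => j i /=; rewrite inE /= => /and3P[iV _ /existsP[k0 lk0]].
rewrite /nxt; case: pickP => [k /andP[lk /forallP mk]|none].
  by split=> // l ll; have := mk l; rewrite ll.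
case: (arg_minP (tau j) lk0) => k lk mk.
have := none k; rewrite lk /= => /negbT /forallPn[l].
by rewrite negb_imply => /andP[ll]; rewrite mk.
Qed.

Lemma nxt_gap g : g \in edges -> min_length <= tau g.1 (nxt g.1 g.2) - tau g.1 g.2.
Proof.
move=> gE; have [/and3P[kV /eqP eb lt] _] := nxtP gE.
move: gE; rewrite inE => /and3P[_ /existsPn nc _].
have := nc (nxt g.1 g.2); rewrite kV /= /close_in_tube eb eqxx /= negb_and negbK -leNgt.
case/orP => [/eqP e|]; first by move: lt; rewrite -e ltxx.
by rewrite ltr0_norm ?subr_lt0 // opprB.
Qed.

(** Segments of one tube join consecutive points, so their ranges along the tube
    do not overlap. *)
Lemma edges_disjoint g h u : g \in edges -> h \in edges -> g.1 = h.1 ->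
  b g.1 g.2 = b h.1 h.2 ->
  tau g.1 g.2 < u < tau g.1 (nxt g.1 g.2) -> tau h.1 h.2 < u < tau h.1 (nxt h.1 h.2) ->
  g = h.
Proof.
case: g => j i; case: h => j' i' /= gE hE ej; move: gE hE; rewrite -{}ej => gE hE eb.
case/andP => l1 l2 /andP[l3 l4]; congr pair.
have iV : i \in V by move: gE; rewrite inE => /and3P[].
have i'V : i' \in V by move: hE; rewrite inE => /and3P[].
case: (ltgtP (tau j i) (tau j i')) => [lt|gt|e].
- have [_ /(_ i')] := nxtP gE; rewrite /= /later i'V eb eqxx lt => /(_ isT) le.
  by move: (lt_le_trans l2 le) => /(lt_trans l3); rewrite ltxx.
- have [_ /(_ i)] := nxtP hE; rewrite /= /later iV eb eqxx gt => /(_ isT) le.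
  by move: (lt_le_trans l4 le) => /(lt_trans l1); rewrite ltxx.
- apply/eqP/negPn/negP => ne; move: gE; rewrite inE => /and3P[_ /existsPn /(_ i')].
  by rewrite i'V /= /close_in_tube ne eb eqxx e subrr normr0 min_length_gt0.
Qed.

Variable T : R.
Definition shear i := x i + T * y i.
Hypothesis shear_inj : injective shear.

Definition lend (g : J * I) := if shear g.2 < shear (nxt g.1 g.2) then g.2 else nxt g.1 g.2.
Definition rend (g : J * I) := if shear g.2 < shear (nxt g.1 g.2) then nxt g.1 g.2 else g.2.

Lemma nxt_neq g : g \in edges -> nxt g.1 g.2 != g.2.
Proof.
move=> gE; have [/and3P[_ _ lt] _] := nxtP gE.
by apply/eqP => e; move: lt; rewrite e ltxx.
Qed.

Lemma edge_ends g : g \in edges -> [/\ lend g \in V, rend g \in V & shear (lend g) < shear (rend g)].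
Proof.
move=> gE; have [/and3P[kV _ _] _] := nxtP gE.
have iV : g.2 \in V by move: gE; rewrite inE => /and3P[].
rewrite /lend /rend; case: ifPn => // ; rewrite -leNgt le_eqVlt => /orP[/eqP /shear_inj e|//].
by move: (nxt_neq gE); rewrite e eqxx.
Qed.

Definition projz j (z w : R) := c j * (z - T * w) + s j * w.
Definition tauz j (z w : R) := - s j * (z - T * w) + c j * w.
Definition bucketz j z w := Num.floor (projz j z w / (2 * delta)).

(** Tubes are convex. *)
Lemma edge_point g z w : g \in edges -> on_seg shear y z w (lend g) (rend g) ->
  bucketz g.1 z w = bucket g.1 g.2 /\
  tau g.1 g.2 < tauz g.1 z w < tau g.1 (nxt g.1 g.2).
Proof.
move=> gE seg.
have [t [t0 t1 ez ew]] : exists t, [/\ 0 < t, t < 1,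
    z = shear g.2 + t * (shear (nxt g.1 g.2) - shear g.2) & w = y g.2 + t * (y (nxt g.1 g.2) - y g.2)].
  move: seg; rewrite /lend /rend; case: ifP => _ [t [t0 t1 ez ew]]; first by exists t.
  exists (1 - t); split; [lra|lra|rewrite ez; ring|rewrite ew; ring].
have [/and3P[kV /eqP /bP eb lt] _] := nxtP gE.
set j := g.1 in eb lt ez ew *; set i := g.2 in eb lt ez ew *.
set k := nxt j i in eb lt ez ew *.
have eP : projz j z w = proj j i + t * (proj j k - proj j i).
  by rewrite /projz /proj ez ew /shear; ring.
have eT : tauz j z w = tau j i + t * (tau j k - tau j i).
  by rewrite /tauz /tau ez ew /shear; ring.
split; last by rewrite eT; apply/andP; split; nra.
have d0 : 0 < 2 * delta by rewrite mulr_gt0.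
have /andP[a1 a2] := bucket_bounds j i; have /andP[a3 a4] := bucket_bounds j k.
rewrite eb in a3 a4.
apply: floor_def; rewrite intrD ler_pdivlMr // ltr_pdivrMr // eP.
apply/andP; split; nra.
Qed.

Lemma edges_plane_graph : plane_graph shear y lend rend V edges.
Proof.
split; [by move=> i k _ _; exact: shear_inj|exact: edge_ends|].
move=> g v gE vV /(edge_point gE).
have -> : bucketz g.1 (shear v) (y v) = bucket g.1 v.
  by congr Num.floor; rewrite /projz /proj /shear; congr (_ / _); ring.
have -> : tauz g.1 (shear v) (y v) = tau g.1 v by rewrite /tauz /tau /shear; ring.
case=> /bP ev /andP[l1 l2]; have [_ /(_ v)] := nxtP gE.
by rewrite /later vV ev eqxx l1 => /(_ isT); rewrite leNgt l2.
Qed.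

(** A segment at least [min_length] long that lies in two tubes would be
    longer than their common slice. *)
Lemma pair_edge_dir g h : g \in edges -> h \in edges ->
  (g.2 = h.2 /\ nxt g.1 g.2 = nxt h.1 h.2) \/ (g.2 = nxt h.1 h.2 /\ nxt g.1 g.2 = h.2) ->
  g.1 = h.1.
Proof.
move=> gE hE ends; apply/eqP/negPn/negP => /det_gt dgt.
have gap := nxt_gap gE.
have [/and3P[_ /eqP /bP ebg ltg] _] := nxtP gE.
have [/and3P[_ /eqP /bP ebh _] _] := nxtP hE.
set k := nxt g.1 g.2 in ends gap ebg ltg; set i := g.2 in ends gap ebg ltg.
have pg : `|proj g.1 k - proj g.1 i| < 2 * delta.
  have := bucket_bounds g.1 k; have := bucket_bounds g.1 i; rewrite ebg.
  by move=> /andP[? ?] /andP[? ?]; rewrite ltr_norml; apply/andP; split; lra.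
have ph : `|proj h.1 k - proj h.1 i| < 2 * delta.
  have := bucket_bounds h.1 (nxt h.1 h.2); have := bucket_bounds h.1 h.2; rewrite ebh.
  case: ends => -[-> ->] /andP[? ?] /andP[? ?]; rewrite ltr_norml; apply/andP; split; lra.
have := rotate_coord g.1 h.1 (x k - x i) (y k - y i).
have -> : c h.1 * (x k - x i) + s h.1 * (y k - y i) = proj h.1 k - proj h.1 i.
  by rewrite /proj; ring.
have -> : c g.1 * (x k - x i) + s g.1 * (y k - y i) = proj g.1 k - proj g.1 i.
  by rewrite /proj; ring.
have -> : - s g.1 * (x k - x i) + c g.1 * (y k - y i) = tau g.1 k - tau g.1 i.
  by rewrite /tau; ring.
set dd := c g.1 * c h.1 + _ => e.
have : `|det g.1 h.1| * (tau g.1 k - tau g.1 i) <= 4 * delta.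
  rewrite -[X in _ * X]ger0_norm; last by have := min_length_gt0; lra.
  rewrite -normrM; have -> : det g.1 h.1 * (tau g.1 k - tau g.1 i) =
    (proj h.1 k - proj h.1 i) - dd * (proj g.1 k - proj g.1 i) by rewrite e; ring.
  apply: le_trans (ler_normB _ _) _; rewrite normrM.
  have := dot_le1 g.1 h.1; rewrite -/dd => d1.
  have : `|dd| * `|proj g.1 k - proj g.1 i| <= 1 * (2 * delta).
    by apply: ler_pM => //; exact: ltW.
  by move: ph; lra.
apply/negP; rewrite -ltNge.
apply: lt_le_trans (_ : r / 2 * min_length <= _); last first.
  by apply: ler_pM => //; [by rewrite divr_ge0 ?ltW|exact: ltW min_length_gt0|exact: ltW].
rewrite /min_length; have -> : r / 2 * (17 * delta / r) = 17 / 2 * delta.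
  by field; exact: lt0r_neq0.
by have := delta0; lra.
Qed.

Lemma edges_simple : {in edges &, forall g h, lend g = lend h -> rend g = rend h -> g = h}.
Proof.
move=> g h gE hE el er.
have ends : (g.2 = h.2 /\ nxt g.1 g.2 = nxt h.1 h.2) \/
    (g.2 = nxt h.1 h.2 /\ nxt g.1 g.2 = h.2).
  move: el er; rewrite /lend /rend; case: ifP => _; case: ifP => _ -> ->; tauto.
have ej := pair_edge_dir gE hE ends.
case: g h gE hE {el er} ends ej => j i [j' i'] /= gE hE ends ej; subst j'.
congr pair; case: ends => -[// ei en].
have [/and3P[_ _ l1] _] := nxtP gE; have [/and3P[_ _ l2] _] := nxtP hE.
by move: l1 l2 => /=; rewrite en -ei => /lt_trans h /h; rewrite ltxx.
Qed.

(** The tubes number [k] in direction [j] and [k'] in direction [j'] meet within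
    [8 delta / r] of a point that depends only on them (solve for [tau] in
    [rotate_coord]); this is the lower end of that window, along [j]. *)
Definition slice_start j (k : int) j' (k' : int) :=
  (2 * delta * k'%:~R - (c j * c j' + s j * s j') * (2 * delta * k%:~R)) / det j j'
    - 8 * delta / r.

(** An edge longer than the window of [slice_start] that meets the window contains
    one of its two ends. *)
Lemma crossing_slice g h : g \in edges -> h \in edges -> g != h ->
  crossing shear y lend rend g h ->
  let l := slice_start g.1 (bucket g.1 g.2) h.1 (bucket h.1 h.2) in
  (tau g.1 g.2 < l -> l < tau g.1 (nxt g.1 g.2)) /\
  (l <= tau g.1 g.2 -> tau g.1 g.2 < l + 16 * delta / r < tau g.1 (nxt g.1 g.2)).
Proof.
move=> gE hE ne /asboolP[z [w [sg sh]]] l.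
have [bg /andP[tg1 tg2]] := edge_point gE sg.
have [bh th] := edge_point hE sh.
have nj : g.1 != h.1.
  apply/eqP => ej; move/eqP: ne; apply.
  apply: (@edges_disjoint g h (tauz g.1 z w)) => //; rewrite ?tg1 // ?ej //.
  by apply/bP; rewrite -[RHS]bh -ej bg.
have dgt := det_gt nj; have d0 : det g.1 h.1 != 0.
  by rewrite -normr_gt0; apply: lt_trans dgt; rewrite divr_gt0.
have gap := nxt_gap gE; have rn := lt0r_neq0 r0.
have dd0 : 0 < 2 * delta by rewrite mulr_gt0.
have bnd j i : bucketz j z w = bucket j i ->
    0 <= projz j z w - 2 * delta * (bucket j i)%:~R < 2 * delta.
  move=> <-; have := floor_itv (projz j z w / (2 * delta)); rewrite -/(bucketz _ _ _) intrD.
  rewrite ler_pdivlMr // ltr_pdivrMr // => /andP[h1 h2]; apply/andP; split; lra.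
have /andP[b1 b2] := bnd _ _ bg; have /andP[b3 b4] := bnd _ _ bh.
have near : `|tauz g.1 z w - (l + 8 * delta / r)| <= 8 * delta / r.
  have e := rotate_coord g.1 h.1 (z - T * w) w.
  rewrite -/(projz h.1 z w) -/(projz g.1 z w) -/(tauz g.1 z w) in e.
  rewrite /l /slice_start subrK.
  set dd := c g.1 * c h.1 + _ in e *.
  set P := projz g.1 z w in b1 b2 e *; set P' := projz h.1 z w in b3 b4 e *.
  have -> : tauz g.1 z w - (2 * delta * (bucket h.1 h.2)%:~R
       - dd * (2 * delta * (bucket g.1 g.2)%:~R)) / det g.1 h.1
     = ((P' - 2 * delta * (bucket h.1 h.2)%:~R)
        - dd * (P - 2 * delta * (bucket g.1 g.2)%:~R)) / det g.1 h.1.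
    by rewrite e; field.
  rewrite normrM normfV ler_pdivrMr ?normr_gt0 //.
  apply: le_trans (_ : 4 * delta <= _).
    apply: le_trans (ler_normB _ _) _; rewrite normrM.
    have := dot_le1 g.1 h.1; rewrite -/dd => d1.
    rewrite (ger0_norm b1) (ger0_norm b3).
    have : `|dd| * (P - 2 * delta * (bucket g.1 g.2)%:~R) <= 1 * (2 * delta).
      by apply: ler_pM => //; exact: ltW.
    lra.
  apply: le_trans (_ : 8 * delta / r * (r / 2) <= _).
    rewrite (_ : 8 * delta / r * (r / 2) = 4 * delta) //; by field.
  by apply: ler_pM => //; [rewrite divr_ge0 ?mulr_ge0 ?ltW|rewrite divr_ge0 ?ltW|exact: ltW].
move: near; rewrite ler_norml => /andP[n1 n2].
have e16 : 16 * delta / r = 2 * (8 * delta / r) by rewrite mulrCA !mulrA; ring.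
have elam : min_length = 17 / 8 * (8 * delta / r) by rewrite /min_length; field.
have p8 : 0 < 8 * delta / r by rewrite divr_gt0 ?mulr_gt0.
rewrite e16; rewrite elam in gap; set e8 := 8 * delta / r in n1 n2 gap p8 *.
split; first by move=> _; lra.
by move=> le; apply/andP; split; lra.
Qed.

Definition slice_code (gh : (J * I) * (J * I)) :=
  let code g h := (g.1, b g.1 g.2,
     tau g.1 g.2 < slice_start g.1 (bucket g.1 g.2) h.1 (bucket h.1 h.2)) in
  (code gh.1 gh.2, code gh.2 gh.1).

(** A crossing pair is determined by its two tubes and by which end of the window
    each edge contains, so two tubes carry at most four crossings. *)
Lemma slice_code_inj : {in crossings shear y lend rend edges &, injective slice_code}.
Proof.
have key g1 h1 g2 h2 : g1 \in edges -> h1 \in edges -> g1 != h1 ->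
    g2 \in edges -> h2 \in edges -> g2 != h2 ->
    crossing shear y lend rend g1 h1 -> crossing shear y lend rend g2 h2 ->
    g1.1 = g2.1 -> h1.1 = h2.1 -> b g1.1 g1.2 = b g2.1 g2.2 -> b h1.1 h1.2 = b h2.1 h2.2 ->
    (tau g1.1 g1.2 < slice_start g1.1 (bucket g1.1 g1.2) h1.1 (bucket h1.1 h1.2)) =
    (tau g2.1 g2.2 < slice_start g2.1 (bucket g2.1 g2.2) h2.1 (bucket h2.1 h2.2)) -> g1 = g2.
  move=> g1E h1E n1 g2E h2E n2 c1 c2 eg eh.
  have := crossing_slice g1E h1E n1 c1; have := crossing_slice g2E h2E n2 c2.
  move: g1E g2E {h1E h2E n1 n2 c1 c2}.
  case: g1 g2 h1 h2 eg eh => j i1 [_ i2] [j' k1] [_ k2] /= <- <- g1E g2E.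
  move=> + + ebg ebh; move: (ebg) (ebh) => /bP -> /bP -> /=.
  set l := slice_start _ _ _ _ => -[a3 a4] [a1 a2] ebit.
  case: (ltP (tau j i1) l) => lt.
    have lt2 : tau j i2 < l by rewrite -ebit lt.
    by apply: (@edges_disjoint (j, i1) (j, i2) l) => //=; rewrite ?lt ?lt2 /= ?a1 ?a3.
  have lt2 : l <= tau j i2 by rewrite leNgt -ebit -leNgt lt.
  by apply: (@edges_disjoint (j, i1) (j, i2) (l + 16 * delta / r)) => //=; [exact: a2|exact: a4].
move=> [g1 h1] [g2 h2] /setIdP[/setXP[g1E h1E] /= /andP[n1 c1]].
move=> /setIdP[/setXP[g2E h2E] /= /andP[n2 c2]].
case=> eg ebg bitg eh ebh bith.
have csym g h : crossing shear y lend rend g h -> crossing shear y lend rend h g.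
  by move=> /asboolP[z [w [? ?]]]; apply/asboolP; exists z, w.
congr pair; first by apply: (key g1 h1 g2 h2).
by apply: (key h1 g1 h2 g2) => //; first [by rewrite eq_sym | exact: csym].
Qed.

Lemma card_crossings : (#|crossings shear y lend rend edges| <= (2 * (#|J| * B)) ^ 2)%N.
Proof.
rewrite -(card_in_imset slice_code_inj); apply: leq_trans (max_card _) _.
by rewrite !card_prod card_bool card_ord -mulnn [(2 * _)%N]mulnC.
Qed.

Definition close_pairs : {set J * (I * I)} :=
  [set g | [&& g.2.1 \in V, g.2.2 \in V & close_in_tube g.1 g.2.1 g.2.2]].

(** In each direction a point starts an edge unless it is the last of its tube or
    has a close companion. *)
Lemma card_edges : (#|J| * #|V| <= #|edges| + #|J| * B + #|close_pairs|)%N.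
Proof.
have Jsum (F : finType) (A : {set J * F}) : #|A| = (\sum_j #|[set i | (j, i) \in A]|)%N.
  rewrite -sum1_card -(eq_bigr _ (fun j _ => sum1_card _)) pair_big_dep /=.
  by apply: eq_bigl => -[j i]; rewrite !inE.
have cst n : (#|J| * n = \sum_(j : J) n)%N by rewrite sum_nat_const.
rewrite (Jsum _ edges) (Jsum _ close_pairs) !cst -!big_split /=.
apply: leq_sum => j _.
set Ej := [set i | _]; set Cj := [set ik | _].
pose Lj := [set i in V | ~~ [exists k in V, close_in_tube j i k] && ~~ [exists k, later j i k]].
have cL : (#|Lj| <= B)%N.
  rewrite -[B]card_ord -(card_in_imset (f := b j)); first exact: max_card.
  move=> i k; rewrite !inE => /and3P[iV nci nli] /and3P[kV nck nlk] eb.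
  apply/eqP/negPn/negP => ne.
  case: (ltgtP (tau j i) (tau j k)) => [lt|lt|e].
  - by case/existsP: nli; exists k; rewrite /later kV eb eqxx.
  - by case/existsP: nlk; exists i; rewrite /later iV eb eqxx.
  - by case/existsP: nci; exists k; rewrite kV /= /close_in_tube ne eb eqxx e subrr normr0 min_length_gt0.
have sub : V \subset Ej :|: Lj :|: [set ik.1 | ik in Cj].
  apply/subsetP => i iV; rewrite !inE iV /=.
  case: (boolP [exists k in V, close_in_tube j i k]) => [/existsP[k /andP[kV ck]]|_] /=.
    apply/imsetP; exists (i, k) => //.
    by rewrite !inE /= iV kV.
  by rewrite orbN.
apply: leq_trans (subset_leq_card sub) _.
apply: leq_trans (leq_card_setU _ _) _; apply: leq_add; last exact: leq_imset_card.
by apply: leq_trans (leq_card_setU _ _) _; rewrite leq_add2l.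
Qed.

End Incidence.

Lemma card_separated (R : archiRealFieldType) (J : finType) (A : {set J})
    (phi : J -> R) (r a l : R) : 0 < r -> 0 <= l ->
  {in A &, forall j k, j != k -> r < `|phi j - phi k|} ->
  {in A, forall j, a <= phi j <= a + l} ->
  #|A|%:R * r <= l + r.
Proof.
move=> r0 l0 sep rng.
pose f j := Num.trunc ((phi j - a) / r).
have fP j : j \in A -> (f j)%:R * r <= phi j - a < (f j).+1%:R * r.
  move=> jA; have /andP[h1 h2] := rng _ jA.
  have q0 : 0 <= (phi j - a) / r by rewrite divr_ge0 ?subr_ge0 ?(ltW r0).
  by have := truncn_itv q0; rewrite ler_pdivlMr // ltr_pdivrMr.
have finj : {in A &, injective f}.
  move=> j k jA kA e; apply/eqP/negPn/negP => ne.
  have := sep _ _ jA kA ne; apply/negP; rewrite -leNgt ler_norml.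
  have := fP _ jA; have := fP _ kA; rewrite e => /andP[h1 h2] /andP[h3 h4].
  by rewrite -natr1 mulrDl mul1r in h2 h4; apply/andP; split; lra.
pose m := Num.trunc (l / r).
have fm j : j \in A -> (f j < m.+1)%N.
  move=> jA; rewrite ltnS; apply: le_truncn.
  by rewrite ler_pM2r ?invr_gt0 //; have /andP[_] := rng _ jA; lra.
have cA : (#|A| <= m.+1)%N.
  rewrite -[m.+1]card_ord -(card_in_imset (f := fun j => inord (f j) : 'I_m.+1)).
    exact: max_card.
  move=> j k jA kA /(congr1 val); rewrite /= !inordK ?fm //; exact: finj.
have : m%:R * r <= l.
  by rewrite -ler_pdivlMr //; have /andP[] := truncn_itv (divr_ge0 l0 (ltW r0)).
have : #|A|%:R * r <= m.+1%:R * r by rewrite ler_pM2r // ler_nat.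
by rewrite -natr1 mulrDl mul1r; lra.
Qed.

Section DirectionCount.
Variables (R : archiRealFieldType) (I J : finType).
Variables (x y : I -> R) (c s phi : J -> R) (delta r : R) (B : nat) (b : J -> I -> 'I_B).

Hypothesis unit_dir : forall j, c j ^+ 2 + s j ^+ 2 = 1.
Hypothesis delta0 : 0 < delta.
Hypothesis r0 : 0 < r.
Hypothesis r1 : r <= 1.
Hypothesis phi_sep : forall j j', j != j' -> r < `|phi j - phi j'|.
Hypothesis phi_lip : forall j j', `|phi j - phi j'| <= 2 * `|det c s j j'|.
Hypothesis phi_rng : forall j, -1 <= phi j <= 1.
Hypothesis pos_inj : forall i k, x i = x k -> y i = y k -> i = k.
Hypothesis bP : forall j i k,
  b j i = b j k <-> bucket x y c s delta j i = bucket x y c s delta j k.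

Local Notation close := (close_in_tube x y c s delta r b).

Definition sup_dist (i k : I) : R := Num.max `|x i - x k| `|y i - y k|.

Lemma sup_dist_gt0 i k : i != k -> 0 < sup_dist i k.
Proof.
move=> ne; rewrite lt_neqAle eq_sym /sup_dist le_max normr_ge0 andbT.
apply/negP => /eqP e; move/eqP: ne; apply.
have := le_max `|x i - x k| `|x i - x k| `|y i - y k|.
have := le_max `|y i - y k| `|x i - x k| `|y i - y k|.
rewrite e !lexx orbT /= !normr_le0 !subr_eq0 => /eqP ey /eqP ex.
exact: pos_inj.
Qed.

Lemma card_dirs : #|J|%:R * r <= 3.
Proof.
have := @card_separated R J setT phi r (-1) 2 r0 (ler0n _ 2).
rewrite cardsT => H; have := r1; suff : #|J|%:R * r <= 2 + r by lra.
apply: H => [j k _ _|j _]; first exact: phi_sep.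
by have := phi_rng j; lra.
Qed.

(** If [i] and [k] lie in a common tube of two directions, both directions are
    nearly orthogonal to [i - k], and their angle is [O(delta / |i - k|)]; hence
    they range over a short arc. *)
Lemma card_close_dirs i k : i != k ->
  #|[set j | close j i k]|%:R * r <= Num.min 3 (35 * delta / sup_dist i k).
Proof.
move=> ne; rewrite le_min; apply/andP; split.
  apply: le_trans card_dirs; rewrite ler_pM2r // ler_nat; exact: max_card.
have D0 := sup_dist_gt0 ne; rewrite ler_pdivlMr //.
have [->|[j0]] := set_0Vmem [set j | close j i k].
  by rewrite cards0 !mul0r mulr_ge0 // ltW.
rewrite inE => cj0.
pose dx := x i - x k; pose dy := y i - y k.
have dn : r != 0 by exact: lt0r_neq0.
have prj j : close j i k -> `|c j * dx + s j * dy| < 2 * delta.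
  case/and3P => _ /eqP /bP eb _.
  have := bucket_bounds x y c s delta0 j i; have := bucket_bounds x y c s delta0 j k.
  rewrite eb => /andP[h1 h2] /andP[h3 h4].
  have -> : c j * dx + s j * dy = proj x y c s j i - proj x y c s j k.
    by rewrite /dx /dy /proj; ring.
  by rewrite ltr_norml; apply/andP; split; lra.
have cs1 j : `|c j| <= 1 /\ `|s j| <= 1.
  have e := unit_dir j; have := sqr_ge0 (c j); have := sqr_ge0 (s j) => h1 h2.
  by split; rewrite -(@ler_pXn2r _ 2) ?nnegrE // -normrX ger0_norm ?expr1n ?sqr_ge0 //; lra.
have two (u v m n p : R) : `|u| <= 1 -> `|v| <= 1 -> `|m| <= n -> `|p| <= n ->
    `|u * m - v * p| <= 2 * n.
  move=> u1 v1 mn pn; apply: le_trans (ler_normB _ _) _; rewrite !normrM.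
  have : `|u| * `|m| <= 1 * n by apply: ler_pM.
  have : `|v| * `|p| <= 1 * n by apply: ler_pM.
  lra.
have detD j : close j i k -> `|det c s j0 j| * sup_dist i k <= 4 * delta.
  move=> cj; have p1 := ltW (prj _ cj); have p2 := ltW (prj _ cj0).
  have [c1 s1] := cs1 j; have [c2 s2] := cs1 j0.
  have e4 : 4 * delta = 2 * (2 * delta) by lra.
  rewrite /sup_dist maxr_pMr // ge_max -!normrM e4; apply/andP; split.
    have -> : det c s j0 j * (x i - x k) =
      s j * (c j0 * dx + s j0 * dy) - s j0 * (c j * dx + s j * dy).
      by rewrite /det /dx /dy; ring.
    exact: two.
  have -> : det c s j0 j * (y i - y k) =
    c j0 * (c j * dx + s j * dy) - c j * (c j0 * dx + s j0 * dy).
    by rewrite /det /dx /dy; ring.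
  exact: two.
have Dle : sup_dist i k * r <= 19 * delta.
  case/and3P: (cj0) => _ _ tl.
  have p2 := ltW (prj _ cj0); have [c2 s2] := cs1 j0.
  have tl' : `|- s j0 * dx + c j0 * dy| <= 17 * delta / r.
    apply: ltW; move: tl; rewrite /min_length; congr (`|_| < _).
    by rewrite /tau /dx /dy; ring.
  have two' (u v m n p q : R) : `|u| <= 1 -> `|v| <= 1 -> `|m| <= n -> `|p| <= q ->
     `|u * m + v * p| <= n + q.
    move=> u1 v1 mn pq; apply: le_trans (ler_normD _ _) _; rewrite !normrM.
    have : `|u| * `|m| <= 1 * n by apply: ler_pM.
    have : `|v| * `|p| <= 1 * q by apply: ler_pM.
    lra.
  have bnd : sup_dist i k <= 2 * delta + 17 * delta / r.
    have one j : c j ^+ 2 + s j ^+ 2 = 1 := unit_dir j.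
    rewrite /sup_dist ge_max; apply/andP; split.
      have -> : x i - x k = c j0 * (c j0 * dx + s j0 * dy) + (- s j0) * (- s j0 * dx + c j0 * dy).
        by rewrite -[LHS]mul1r -(one j0) /dx; ring.
      by apply: two'; rewrite ?normrN.
    have -> : y i - y k = s j0 * (c j0 * dx + s j0 * dy) + c j0 * (- s j0 * dx + c j0 * dy).
      by rewrite -[LHS]mul1r -(one j0) /dy; ring.
    exact: two'.
  have := ler_wpM2r (ltW r0) bnd; rewrite mulrDl divfK //.
  have : 2 * delta * r <= 2 * delta * 1 by rewrite ler_pM2l // mulr_gt0.
  by lra.
have cnt : #|[set j | close j i k]|%:R * r <= 16 * delta / sup_dist i k + r.
  apply: (@card_separated _ _ _ phi r (phi j0 - 8 * delta / sup_dist i k)) => //.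
  - by rewrite divr_ge0 ?mulr_ge0 ?ltW.
  - by move=> j j' _ _; exact: phi_sep.
  - move=> j; rewrite inE => cj.
    have h : `|phi j0 - phi j| <= 8 * delta / sup_dist i k.
      rewrite ler_pdivlMr //; have := detD _ cj; have := phi_lip j0 j => h1 h2.
      have := ler_wpM2r (ltW D0) h1; lra.
    have e16 : 16 * delta / sup_dist i k = 2 * (8 * delta / sup_dist i k).
      by field; exact: lt0r_neq0.
    move: h; rewrite ler_norml e16 => /andP[h1 h2]; apply/andP; split; lra.
have := ler_wpM2r (ltW D0) cnt; rewrite mulrDl divfK; last exact: lt0r_neq0.
by have := delta0; lra.
Qed.

Local Notation close_pairs := (close_pairs x y c s delta r b).

(** Each vertex starts edges in most directions, so there are at least
    [#|J| * #|V| / 2] edges, while [card_crossings] allows [4 (#|J| * B) ^+ 2]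
    crossings.  Compare with [crossing_lemma]. *)
Lemma incidence_bound (V : {set I}) : (16 <= #|J|)%N -> (4 * B <= #|V|)%N ->
  (4 * #|close_pairs V| <= #|J| * #|V|)%N -> (#|J| * #|V| <= 4096 * B ^ 2)%N.
Proof.
move=> J16 B4 W4; have [T XT] := generic_shear pos_inj.
have pg := edges_plane_graph r delta0 bP V XT.
have sim := edges_simple unit_dir delta0 r0 phi_sep phi_lip bP (V := V) (T := T).
have cE := card_edges x y c s b delta0 r0 V.
have cX := card_crossings unit_dir delta0 r0 phi_sep phi_lip bP V T.
have := crossing_lemma pg sim.
set E := #|edges _ _ _ _ _ _ _ _| in cE *; set C := #|crossings _ _ _ _ _| in cX *.
set n := #|V| in B4 W4 cE *; set N := #|J| in J16 W4 cE cX *.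
have NB : (4 * (N * B) <= N * n)%N by rewrite mulnCA leq_mul2l B4 orbT.
have E2 : (N * n <= 2 * E)%N.
  by move: cE NB W4; move: (N * n)%N (N * B)%N => u v; lia.
have E8 : (8 * n <= E)%N.
  rewrite -(leq_pmul2l (_ : 0 < 2)%N) // mulnA; apply: leq_trans E2.
  by rewrite leq_mul2r J16 orbT.
move=> /(_ E8) main.
have [->|n0] := posnP n; first by rewrite muln0.
have Npos : (0 < N)%N by apply: leq_trans J16.
have : ((N * n) ^ 3 <= 8 * (128 * n ^ 2 * (2 * (N * B)) ^ 2))%N.
  apply: leq_trans (_ : (2 * E) ^ 3 <= _)%N; first by rewrite leq_exp2r.
  rewrite expnMn leq_mul2l /=; apply: leq_trans main _.
  by rewrite leq_mul2l cX orbT.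
have -> : ((N * n) ^ 3 = (N * n) ^ 2 * (N * n))%N by rewrite -expnSr.
have -> : (8 * (128 * n ^ 2 * (2 * (N * B)) ^ 2) = (N * n) ^ 2 * (4096 * B ^ 2))%N.
  by rewrite !expnMn -[4096%N]/(8 * 128 * 2 ^ 2)%N; ring.
by rewrite leq_pmul2l // expn_gt0 muln_gt0 Npos n0.
Qed.

Variables (Lam kappa M h : R).
Hypothesis Lam_energy : forall i,
  \sum_(k | k != i) Num.min 3 (35 * delta / sup_dist i k) <= Lam.
Hypothesis Lam1 : 1 <= Lam.
Hypothesis kappa0 : 0 < kappa.
Hypothesis kappa1 : kappa <= 1.
Hypothesis kappa_card : kappa <= delta * #|I|%:R.
Hypothesis BM : B%:R <= 2 * M.
Hypothesis M2 : 1 <= M ^+ 2 * delta.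
Hypothesis M0 : 0 < M.
Hypothesis h0 : 0 < h.
Hypothesis h2 : h ^+ 2 = delta / r.
Hypothesis h1 : h <= 1.

Lemma card_close_pairs : #|close_pairs [set: I]|%:R * r <= #|I|%:R * Lam.
Proof.
have -> : #|close_pairs [set: I]|%:R =
    \sum_i \sum_(k | k != i) #|[set j | close j i k]|%:R :> R.
  rewrite -sum1_card natr_sum.
  rewrite (reindex (fun g : I * (I * J) => (g.2.2, (g.1, g.2.1)))) /=; last first.
    exists (fun g : J * (I * I) => (g.2.1, (g.2.2, g.1))) => [[i [k j]]|[j [i k]]] _ //.
  rewrite [LHS](eq_bigl (fun g : I * (I * J) => close g.2.2 g.1 g.2.1)); last first.
    by move=> [i [k j]]; rewrite !inE.
  rewrite -(pair_big_dep xpredT (fun i (kj : I * J) => close kj.2 i kj.1) (fun _ _ => 1)) /=.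
  apply: eq_bigr => i _.
  rewrite -(pair_big_dep xpredT (fun k j => close j i k) (fun _ _ => 1)) /=.
  rewrite (bigID (fun k => k != i)) /= [X in _ + X]big1 ?addr0.
    by apply: eq_bigr => k _; rewrite -sum1_card natr_sum; apply: eq_bigl => j; rewrite inE.
  move=> k /negPn/eqP ->; rewrite big_pred0 // => j.
  by rewrite /close_in_tube eqxx.
rewrite mulr_suml mulrC mulr_natr -[X in _ <= X]sumr_const.
apply: ler_sum => i _; rewrite mulr_suml; apply: le_trans (Lam_energy i).
by apply: ler_sum => k ne; apply: card_close_dirs; rewrite eq_sym.
Qed.

(** Close pairs survive in a random subset with the square of its density [q],
    points with [q].  With [q = #|J| r / (8 Lam)] the expected number of close pairs
    is at most a fraction of [#|J|] per point kept. *)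
Lemma random_subset_few_close : exists V : {set I},
  #|J|%:R * r * kappa <= 16 * Lam * delta * #|V|%:R /\
  (4 * #|close_pairs V| <= #|J| * #|V|)%N.
Proof.
pose N : R := #|J|%:R; pose n : R := #|I|%:R.
have N0 : 0 <= N by exact: ler0n.
have n0 : 0 <= n by exact: ler0n.
have L0 : 0 < Lam by apply: lt_le_trans Lam1.
have L0' := ltW L0; have r0' := ltW r0; have d0' := ltW delta0; have k0' := ltW kappa0.
pose q : R := N * r / (8 * Lam).
have q0 : 0 <= q by rewrite divr_ge0 ?mulr_ge0.
have q1 : q <= 1.
  rewrite ler_pdivrMr ?mulr_gt0 // mul1r; have := card_dirs; rewrite -/N.
  have := Lam1; lra.
have E1 := expect_count q (J := I) (P := setT) (S := fun v => [set v]) (k := 1)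
  (fun v _ => cards1 v).
have E2 := expect_count q (P := close_pairs setT)
  (S := fun g : J * (I * I) => [set g.2.1; g.2.2]) (k := 2).
have {}E2 := E2 _.
have [|V HV] := @exists_ge_expect R I q q0 q1
  (fun V => N / 4 * #|V|%:R - #|close_pairs V|%:R) (q * N * n / 8).
  have -> : \sum_A weight q A * (N / 4 * #|A|%:R - #|close_pairs A|%:R) =
     N / 4 * (q * n) - q ^+ 2 * #|close_pairs setT|%:R.
    have -> : q * n = q ^+ 1 * #|[set: I]|%:R by rewrite expr1 cardsT.
    rewrite -E1 -E2; last first.
      move=> [j [i k]]; rewrite inE => /and3P[_ _ /and3P[ne _ _]] /=.
      by rewrite cards2 ne.
    rewrite mulr_sumr -sumrB; apply: eq_bigr => A _; rewrite mulrBr mulrCA.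
    congr (_ * (_ * _%:R) - _ * _%:R).
      by apply: eq_card => v; rewrite !inE sub1set.
    apply: eq_card => -[j [i k]]; rewrite !inE /= subUset !sub1set.
    by rewrite [RHS]andbC andbA.
  have W := card_close_pairs; rewrite -/n in W.
  set w : R := #|close_pairs setT|%:R in W *.
  have : q * w <= N * n / 8.
    rewrite /q; have -> : N * r / (8 * Lam) * w = N / 8 * (w * r) / Lam.
      by field; exact: lt0r_neq0.
    rewrite ler_pdivrMr //; have -> : N * n / 8 * Lam = N / 8 * (n * Lam) by ring.
    by apply: ler_wpM2l; rewrite ?divr_ge0.
  move=> /(ler_wpM2l q0); lra.
exists V.
have w0 : 0 <= #|close_pairs V|%:R :> R by exact: ler0n.
have pos : 0 <= q * N * n / 8.
  by apply: divr_ge0 => //; apply: mulr_ge0 => //; apply: mulr_ge0.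
split; last first.
  by rewrite -(ler_nat R) !natrM -/N; lra.
have [N00|Npos] : N = 0 \/ 0 < N.
  by move: N0; rewrite le_eqVlt => /orP[/eqP|]; [left|right].
  by rewrite -/N N00 !mul0r; apply: mulr_ge0 => //; apply: mulr_ge0 => //; apply: mulr_ge0.
have nq : q * n / 2 <= #|V|%:R.
  rewrite -(ler_pM2l Npos); lra.
have := ler_wpM2r (_ : 0 <= 16 * Lam * delta) nq.
have -> : q * n / 2 * (16 * Lam * delta) = N * r * (delta * n).
  by rewrite /q; field; exact: lt0r_neq0.
move=> H; rewrite [X in _ <= X]mulrC; apply: le_trans (H _).
  by apply: ler_wpM2l; rewrite ?mulr_ge0.
by rewrite !mulr_ge0.
Qed.

(** If the subset of [random_subset_few_close] has at least [4 B] points,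
    [incidence_bound] applies to it; if not, its lower bound on the number of points
    already limits [#|J|].  For [#|J| < 16] use [M * h >= 1], where
    [h = sqrt (delta / r)]. *)
Theorem card_directions : #|J|%:R <= 512 * (Lam / kappa) * M * h.
Proof.
have [V [Vbig Vclose]] := random_subset_few_close.
have Lk : 1 <= Lam / kappa by rewrite ler_pdivlMr // mul1r; exact: le_trans Lam1.
have rn := lt0r_neq0 r0; have kn := lt0r_neq0 kappa0.
have Mh : 1 <= M * h.
  rewrite -(@ler_pXn2r _ 2) ?nnegrE ?ler01 ?mulr_ge0 ?(ltW M0) ?(ltW h0) //.
  by rewrite expr1n exprMn h2 mulrA ler_pdivlMr // mul1r; apply: le_trans M2.
have hn : delta = h ^+ 2 * r by rewrite h2 divfK.
have LMh : 1 <= Lam / kappa * (M * h) by rewrite -[1]mulr1; apply: ler_pM.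
have [J16|] := leqP 16 #|J|; last first.
  rewrite -(ltr_nat R) => lt; apply: ltW; apply: lt_le_trans lt _.
  rewrite -!mulrA mulrA; lra.
have [B4|] := leqP (4 * B) #|V|; last first.
  rewrite -(ltr_nat R) natrM => lt.
  have lt8 : #|V|%:R <= 8 * M by have := BM; lra.
  have d0 : 0 <= 16 * Lam * delta by rewrite !mulr_ge0 ?(ltW delta0) //; apply: le_trans Lam1.
  have := le_trans Vbig (ler_wpM2l d0 lt8); rewrite hn.
  have -> : 16 * Lam * (h ^+ 2 * r) * (8 * M) = (128 * Lam * M * h ^+ 2) * r by ring.
  rewrite mulrAC ler_pM2r // => H.
  have H2 : #|J|%:R <= 128 * (Lam / kappa) * M * h ^+ 2.
    rewrite (_ : 128 * (Lam / kappa) * M * h ^+ 2 = 128 * Lam * M * h ^+ 2 / kappa); last by field.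
    by rewrite ler_pdivlMr.
  apply: le_trans H2 _; have -> : 128 * (Lam / kappa) * M * h ^+ 2 = 128 * (Lam / kappa * (M * h)) * h by ring.
  have -> : 512 * (Lam / kappa) * M * h = 512 * (Lam / kappa * (M * h)) by ring.
  set Z := Lam / kappa * (M * h) in LMh *.
  have Z0 : 0 <= 128 * Z by lra.
  by have := ler_wpM2l Z0 h1; lra.
have := incidence_bound J16 B4 Vclose.
rewrite -(ler_nat R) (natrM _ #|J|) (natrM _ 4096) natrX.
have B2 : B%:R ^+ 2 <= (2 * M) ^+ 2 by rewrite ler_pXn2r ?nnegrE ?ler0n // mulr_ge0 // ltW.
set N := #|J|%:R in Vbig *; set n := #|V|%:R in Vbig * => H.
have {}H : N * n <= 16384 * M ^+ 2 by rewrite exprMn in B2; lra.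
have N0 : 0 <= N by exact: ler0n.
have L0 : 0 < Lam by apply: lt_le_trans Lam1.
have L0' := ltW L0; have r0' := ltW r0; have d0' := ltW delta0; have k0' := ltW kappa0.
have z : 0 <= Lam / kappa := le_trans ler01 Lk.
have rhs0 : 0 <= 512 * (Lam / kappa) * M * h :=
  mulr_ge0 (mulr_ge0 (mulr_ge0 (ler0n R 512) z) (ltW M0)) (ltW h0).
rewrite -(ler_pXn2r (isT : (0 < 2)%N) (N0 : N \is Num.nneg) (rhs0 : _ \is Num.nneg)).
have A1 : N ^+ 2 * r * kappa <= 16 * Lam * delta * (16384 * M ^+ 2).
  have -> : N ^+ 2 * r * kappa = N * (N * r * kappa) by ring.
  apply: le_trans (ler_wpM2l N0 Vbig) _.
  have -> : N * (16 * Lam * delta * n) = 16 * Lam * delta * (N * n) by ring.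
  by apply: ler_wpM2l => //; rewrite !mulr_ge0 ?(ltW delta0) ?(ltW L0).
rewrite hn in A1.
have A2 : N ^+ 2 <= 512 ^+ 2 * (Lam / kappa) * (M * h) ^+ 2.
  rewrite -(ler_pM2r r0) -(ler_pM2r kappa0); apply: le_trans A1 _.
  have -> : 512 ^+ 2 * (Lam / kappa) * (M * h) ^+ 2 * r * kappa =
     16 * Lam * (h ^+ 2 * r) * (16384 * M ^+ 2) by field.
  exact: lexx.
apply: le_trans A2 _.
have -> : (512 * (Lam / kappa) * M * h) ^+ 2 =
   512 ^+ 2 * (Lam / kappa) * (M * h) ^+ 2 * (Lam / kappa) by ring.
exact: (ler_peMr (mulr_ge0 (mulr_ge0 (sqr_ge0 _) z) (sqr_ge0 _)) Lk).
Qed.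
End DirectionCount.

(** * Finite one-dimensional sets *)

Section Dyadic.
Variables (T : finType) (u v : T -> nat).

Definition same_cell m a b := (u a %/ 2 ^ m == u b %/ 2 ^ m)%N && (v a %/ 2 ^ m == v b %/ 2 ^ m)%N.

Lemma same_cellxx m a : same_cell m a a.
Proof. by rewrite /same_cell !eqxx. Qed.

Lemma same_cell_sym m a b : same_cell m a b = same_cell m b a.
Proof. by rewrite /same_cell eq_sym [X in _ && X]eq_sym. Qed.

Lemma same_cell_trans m a b c : same_cell m a b -> same_cell m b c -> same_cell m a c.
Proof. by rewrite /same_cell => /andP[/eqP -> /eqP ->]. Qed.

Lemma same_cell_up m k a b : (m <= k)%N -> same_cell m a b -> same_cell k a b.
Proof.
move=> mk /andP[/eqP e1 /eqP e2]; rewrite /same_cell -(subnKC mk) expnD !divnMA.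
by rewrite e1 e2 !eqxx.
Qed.

Definition mass (P : {set T}) m a := #|[set b in P | same_cell m a b]|.

Lemma mass_same P m a b : same_cell m a b -> mass P m a = mass P m b.
Proof.
move=> ab; apply: eq_card => c; rewrite !inE; congr andb; apply/idP/idP.
  by apply: same_cell_trans; rewrite same_cell_sym.
exact: same_cell_trans.
Qed.

Variables (X : {set T}) (n : nat).

(** Take [P] of maximal cardinality under the capacity constraints: a point that
    cannot be added lies in a cell that is already full. *)
Lemma maximal_frostman : exists P : {set T}, [/\ P \subset X,
  forall m a, (m <= n)%N -> (mass P m a <= 2 ^ m)%N &
  forall a, a \in X -> exists2 m, (m <= n)%N & mass P m a = (2 ^ m)%N].
Proof.
pose ok (P : {set T}) := (P \subset X) && [forall m : 'I_n.+1, forall a, mass P m a <= 2 ^ m]%N.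
have ok0 : ok set0.
  rewrite /ok sub0set; apply/forallP => m; apply/forallP => a.
  rewrite /mass (_ : [set b in set0 | _] = set0) ?cards0 //.
  by apply/setP => b; rewrite !inE.
case: (arg_maxnP (fun P : {set T} => #|P|) ok0) => P /andP[PX /forallP okP] maxP.
have massP m a : (m <= n)%N -> (mass P m a <= 2 ^ m)%N.
  by move=> mn; have /forallP := okP (inord m); move=> /(_ a); rewrite inordK ?ltnS.
exists P; split=> // a aX; case: (boolP (a \in P)) => [aP|aP].
  exists 0%N => //; apply/eqP; rewrite eqn_leq massP //= expn0 card_gt0.
  by apply/set0Pn; exists a; rewrite inE aP same_cellxx.
have : ~~ ok (a |: P).
  by apply/negP => /maxP /=; rewrite cardsU1 aP add1n ltnn.
rewrite /ok subUset sub1set aX PX /= => /forallPn[m /forallPn[b]].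
rewrite -ltnNge => lt.
have mn : (m <= n)%N by rewrite -ltnS.
have ba : same_cell m b a.
  apply/negPn/negP => nba; move: lt; apply/negP; rewrite -leqNgt.
  apply: leq_trans (massP m b mn); apply: subset_leq_card; apply/subsetP => c.
  by rewrite !inE => /andP[/orP[/eqP ->|->] //]; rewrite (negbTE nba).
exists m => //; apply/eqP; rewrite eqn_leq massP //= -(mass_same _ ba) -ltnS.
apply: leq_trans lt _; apply: leq_trans (_ : #|a |: [set c in P | same_cell m b c]| <= _)%N.
  apply: subset_leq_card; apply/subsetP => c; rewrite !inE.
  by case/andP => /orP[-> //|->] ->; rewrite orbT.
by rewrite cardsU1; case: (_ \in _).
Qed.

(** The maximal full cells cover [X] and are disjoint; a full cell of side [2 ^ m]
    contains [2 ^ m] points of [P]. The set [Y] picks one point of [X] in each of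
    them, and [lev] is the level of the cell. *)
Lemma frostman_cover : exists (P Y : {set T}) (lev : T -> nat), [/\ P \subset X,
  forall m a, (m <= n)%N -> (mass P m a <= 2 ^ m)%N,
  forall a, a \in X -> exists2 y, y \in Y & same_cell (lev y) y a &
  (\sum_(y in Y) 2 ^ lev y <= #|P|)%N].
Proof.
have [P [PX massP tightP]] := maximal_frostman.
pose tight a (m : 'I_n.+1) := mass P m a == (2 ^ m)%N.
pose lev a := \max_(m < n.+1 | tight a m) m.
have lev_tight a : (exists2 m, (m <= n)%N & mass P m a = (2 ^ m)%N) ->
    mass P (lev a) a = (2 ^ lev a)%N.
  case=> m mn tm; have [|m0 t0 e] := @eq_bigmax_cond _ (tight a) (@nat_of_ord n.+1).
    apply/card_gt0P; exists (inord m); rewrite unfold_in /tight inordK ?ltnS //; exact/eqP.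
  by rewrite /lev e; apply/eqP.
have lev_max a m : (m <= n)%N -> mass P m a = (2 ^ m)%N -> (m <= lev a)%N.
  move=> mn tm.
  have t : tight a (inord m) by rewrite /tight inordK ?ltnS //; apply/eqP.
  have := leq_bigmax_cond (F := @nat_of_ord n.+1) _ t; by rewrite inordK ?ltnS.
have levn a : (lev a <= n)%N by apply/bigmax_leqP => m _; rewrite -ltnS.
have lev_same a b : a \in X -> same_cell (lev a) a b -> lev b = lev a.
  move=> aX ab; have ta := lev_tight _ (tightP _ aX).
  have tb : mass P (lev a) b = (2 ^ lev a)%N by rewrite -(mass_same _ ab).
  have le1 := lev_max _ _ (levn a) tb.
  apply/eqP; rewrite eqn_leq le1 andbT; apply: lev_max => //.
  rewrite (mass_same _ (same_cell_up le1 ab)); apply: lev_tight; by exists (lev a).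
pose eqv a b := (b \in X) && same_cell (lev a) a b.
have eqvP a b c : a \in X -> eqv a b -> eqv b c = eqv a c.
  move=> aX /andP[bX ab]; rewrite /eqv (lev_same _ _ aX ab); congr andb.
  apply/idP/idP; first exact: same_cell_trans.
  by apply: same_cell_trans; rewrite same_cell_sym.
pose rep a := odflt a [pick b | eqv a b].
have rep_eqv a : a \in X -> eqv a (rep a).
  move=> aX; rewrite /rep; case: pickP => //= /(_ a).
  by rewrite /eqv aX same_cellxx.
have rep_eq a b : a \in X -> eqv a b -> rep a = rep b.
  move=> aX ab; have e c : eqv b c = eqv a c by exact: eqvP.
  rewrite /rep (eq_pick e); case: pickP => //= /(_ a).
  by rewrite /eqv aX same_cellxx.
exists P, (rep @: X), lev; split=> //.
  move=> a aX; exists (rep a); first exact: imset_f.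
  have /andP[rX ar] := rep_eqv _ aX.
  by rewrite (lev_same _ _ aX ar) same_cell_sym.
have repX y : y \in rep @: X -> y \in X /\ rep y = y.
  case/imsetP => a aX ->; have re := rep_eqv _ aX; have /andP[rX _] := re.
  by split=> //; rewrite -(rep_eq _ _ aX re).
rewrite (eq_bigr (fun y => \sum_(z in P) same_cell (lev y) y z : nat)); last first.
  move=> y /repX [yX _]; rewrite -(lev_tight _ (tightP _ yX)) /mass -sum1_card.
  by rewrite big_mkcond [RHS]big_mkcond; apply: eq_bigr => z _; rewrite inE; case: (z \in P); case: (same_cell _ _ _).
rewrite exchange_big -sum1_card; apply: leq_sum => z zP.
have zX : z \in X by apply: (subsetP PX).
rewrite -big_mkcondr sum1_card; apply/card_le1_eqP => y1 y2.
rewrite !unfold_in => /andP[/repX[y1X r1] s1] /andP[/repX[y2X r2] s2].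
have e1 : eqv y1 z by rewrite /eqv zX.
have e2 : eqv y2 z by rewrite /eqv zX.
by rewrite -r1 -r2 (rep_eq _ _ y1X e1) (rep_eq _ _ y2X e2).
Qed.
End Dyadic.

Section Energy.
Variables (R : archiRealFieldType) (I : finType) (x y : I -> R) (u v : I -> nat).
Variables (n : nat) (delta : R).
Hypothesis delta0 : 0 < delta.
Hypothesis delta_lt : delta * 2 ^+ n <= 2.
Hypothesis xb : forall i, -1 <= x i <= 1.
Hypothesis yb : forall i, -1 <= y i <= 1.
Hypothesis uP : forall i, (u i)%:R <= (x i + 1) * 2 ^+ n < (u i).+1%:R.
Hypothesis vP : forall i, (v i)%:R <= (y i + 1) * 2 ^+ n < (v i).+1%:R.
Hypothesis cells : forall m i, (m <= n.+1)%N -> (mass u v setT m i <= 2 ^ m)%N.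

Lemma near_cells (w : I -> nat) (z : I -> R) m i k :
  (forall i, (w i)%:R <= (z i + 1) * 2 ^+ n < (w i).+1%:R) ->
  `|z i - z k| * 2 ^+ n <= 2 ^+ m ->
  exists d : 'I_3, (w k %/ 2 ^ m + 1 = w i %/ 2 ^ m + d)%N.
Proof.
move=> wP zz.
have key a b : `|z a - z b| * 2 ^+ n <= 2 ^+ m -> (w a %/ 2 ^ m <= w b %/ 2 ^ m + 1)%N.
  move=> zab; have : (w a <= w b + 2 ^ m)%N.
    rewrite -ltnS -(ltr_nat R) -addSn natrD natrX.
    have /andP[h1 h2] := wP a; have /andP[h3 h4] := wP b.
    have p : 0 < 2 ^+ n :> R by rewrite exprn_gt0.
    have := ler_norm (z a - z b) => /(ler_wpM2r (ltW p)); lra.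
  move=> /(leq_div2r (2 ^ m)) /leq_trans; apply.
  by rewrite divnDr ?divnn ?expn_gt0.
have k1 := key _ _ zz; rewrite distrC in zz; have k2 := key _ _ zz.
have lt : (w k %/ 2 ^ m + 1 - w i %/ 2 ^ m < 3)%N by lia.
exists (Ordinal lt) => /=; lia.
Qed.

(** A ball meets at most nine cells of its own size. *)
Lemma card_ball i m : (m <= n.+1)%N ->
  (#|[set k | (sup_dist x y i k * 2 ^+ n <= 2 ^+ m)%R]| <= 9 * 2 ^ m)%N.
Proof.
move=> mn.
pose C (d : 'I_3 * 'I_3) := [set k | (u k %/ 2 ^ m + 1 == u i %/ 2 ^ m + d.1)%N &&
   (v k %/ 2 ^ m + 1 == v i %/ 2 ^ m + d.2)%N].
have sub : [set k | sup_dist x y i k * 2 ^+ n <= 2 ^+ m] \subset \bigcup_d C d.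
  apply/subsetP => k; rewrite inE /sup_dist maxr_pMl ?exprn_ge0 // ge_max => /andP[hx hy].
  have [d1 e1] := near_cells uP hx; have [d2 e2] := near_cells vP hy.
  by apply/bigcupP; exists (d1, d2) => //; rewrite inE /= e1 e2 !eqxx.
apply: leq_trans (subset_leq_card sub) _.
apply: leq_trans (_ : \sum_d #|C d| <= _)%N.
  elim/big_rec2 : _ => [|d s A _ le]; first by rewrite cards0.
  by apply: leq_trans (leq_card_setU _ _) _; rewrite leq_add2l.
apply: leq_trans (_ : \sum_(d : 'I_3 * 'I_3) 2 ^ m <= _)%N; last first.
  by rewrite sum_nat_const card_prod !card_ord.
apply: leq_sum => d _; have [->|[k0 k0C]] := set_0Vmem (C d); first by rewrite cards0.
apply: leq_trans (cells k0 mn); apply: subset_leq_card; apply/subsetP => k.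
move: k0C; rewrite !inE /same_cell /= => /andP[/eqP e1 /eqP e2] /andP[/eqP e3 /eqP e4].
by apply/andP; split; apply/eqP; apply: (@addIn 1); rewrite ?e1 ?e2 ?e3 ?e4.
Qed.

(** Each dyadic scale contributes a bounded amount, and there are [n + 2] scales
    between [delta] and the diameter.  This is the source of the logarithm. *)
Lemma energy_bound i : (forall k, k != i -> 0 < sup_dist x y i k) ->
  \sum_(k | k != i) Num.min 3 (35 * delta / sup_dist x y i k) <= 1260 * n.+2%:R.
Proof.
move=> pos.
(* At the least [m] for which [k] is in the ball of radius [2 ^ (m - n)], the share
   [W m k] of scale [m] dominates the summand of [k]. *)
pose W (m : nat) k : R := if sup_dist x y i k * 2 ^+ n <= 2 ^+ m then 140 / 2 ^+ m else 0.
have p2 m : 0 < 2 ^+ m :> R by rewrite exprn_gt0.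
have W0 m k : 0 <= W m k by rewrite /W; case: ifP => // _; rewrite divr_ge0 ?ltW.
have term k : k != i ->
    Num.min 3 (35 * delta / sup_dist x y i k) <= \sum_(m < n.+2) W m k.
  move=> ki; have D0 := pos _ ki; set D := sup_dist x y i k in D0 *.
  have ex : exists m, D * 2 ^+ n <= 2 ^+ m.
    exists n.+1; rewrite exprS ler_pM2r // /D /sup_dist ge_max.
    have := xb i; have := xb k; have := yb i; have := yb k.
    move=> /andP[? ?] /andP[? ?] /andP[? ?] /andP[? ?].
    by rewrite !ler_norml; apply/andP; split; apply/andP; split; lra.
  have mn : (ex_minn ex < n.+2)%N.
    case: ex_minnP => m _ /(_ n.+1); rewrite ltnS; apply.
    rewrite exprS ler_pM2r // /D /sup_dist ge_max.
    have := xb i; have := xb k; have := yb i; have := yb k.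
    move=> /andP[? ?] /andP[? ?] /andP[? ?] /andP[? ?].
    by rewrite !ler_norml; apply/andP; split; apply/andP; split; lra.
  apply: le_trans (_ : W (ex_minn ex) k <= _); last first.
    rewrite (bigD1 (Ordinal mn)) //= lerDl sumr_ge0 // => m _; exact: W0.
  case: ex_minnP => m Dm minm; rewrite /W -/D Dm ge_min.
  case: m Dm minm {mn} => [|m] Dm minm.
    by rewrite expr0 divr1; apply/orP; left; lra.
  apply/orP; right.
  have : 2 ^+ m < D * 2 ^+ n by rewrite ltNge; apply/negP => /minm; rewrite ltnn.
  move=> lt; rewrite ler_pdivrMr // mulrAC ler_pdivlMr // exprS.
  have e : 35 * delta * (2 * 2 ^+ m) <= 70 * delta * (D * 2 ^+ n).
    have -> : 35 * delta * (2 * 2 ^+ m) = 70 * delta * 2 ^+ m by ring.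
    by apply: ler_wpM2l; [rewrite mulr_ge0 ?(ltW delta0)|exact: ltW].
  apply: le_trans e _.
  have -> : 70 * delta * (D * 2 ^+ n) = 70 * D * (delta * 2 ^+ n) by ring.
  have : 0 <= 70 * D by rewrite mulr_ge0 ?(ltW D0).
  by move=> /ler_wpM2l /(_ _ _ delta_lt); lra.
apply: le_trans (ler_sum _ (fun k h => term k h)) _.
apply: le_trans (_ : \sum_k \sum_(m < n.+2) W m k <= _).
  rewrite [leRHS](bigID (fun k => k != i)) /= lerDl sumr_ge0 // => k _.
  by apply: sumr_ge0 => m _; exact: W0.
rewrite exchange_big /=; apply: le_trans (_ : \sum_(m < n.+2) 1260 <= _); last first.
  by rewrite sumr_const card_ord mulr_natr.
apply: ler_sum => -[m /= mn] _; rewrite -big_mkcond /= sumr_const.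
have := card_ball i (m := m) mn; rewrite -(ler_nat R) natrM natrX => h.
rewrite -[_ / _ *+ _]mulr_natr mulrAC ler_pdivrMr //.
rewrite (_ : #|_| = #|[set k | sup_dist x y i k * 2 ^+ n <= 2 ^+ m]|); last first.
  by apply: eq_card => k; rewrite inE.
lra.
Qed.
End Energy.

(** * Coprime pairs *)

Lemma card_multiples (P d : nat) : (0 < d)%N ->
  (#|[set i : 'I_P | (d %| i.+1)%N]| <= P %/ d)%N.
Proof.
move=> d0; case E : (P %/ d)%N => [|k].
  rewrite leqn0 cards_eq0; apply/eqP/setP => i; rewrite !inE; apply/negP => /dvdn_leq.
  move=> /(_ isT) le; have := leq_trans le (ltn_ord i).
  by move=> /(leq_div2r d); rewrite divnn d0 E.
rewrite -(card_in_imset (f := fun i : 'I_P => inord (i.+1 %/ d).-1 : 'I_k.+1)).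
  by apply: leq_trans (max_card _) _; rewrite card_ord.
have fP (i : 'I_P) : (d %| i.+1)%N -> (0 < i.+1 %/ d <= k.+1)%N.
  move=> di; rewrite divn_gt0 // dvdn_leq //= -E; exact: leq_div2r.
move=> i j; rewrite !inE => di dj /(congr1 val) /=.
have /andP[i0 ik] := fP _ di; have /andP[j0 jk] := fP _ dj.
rewrite !inordK ?prednK //; try by rewrite ltnS -ltnS prednK.
move=> e; apply: val_inj; apply: succn_inj; rewrite -(divnK di) -(divnK dj).
by rewrite -(prednK i0) -(prednK j0) e.
Qed.

Lemma sum_inv_sqr_le (R : realFieldType) n :
  \sum_(2 <= d < n.+2) (d%:R ^- 2 : R) <= 3 / 4.
Proof.
suff: \sum_(2 <= d < n.+3) (d%:R ^- 2 : R) <= 3 / 4 - n.+2%:R^-1.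
  move=> h; apply: le_trans (le_trans h _); last by rewrite gerBl invr_ge0.
  by rewrite [leRHS]big_nat_recr //= lerDl invr_ge0 exprn_ge0.
elim: n => [|n IH]; first by rewrite big_nat1 (_ : 2 ^- 2 = 1 / 4); [lra|field].
rewrite big_nat_recr //=; set S := \sum_(_ <= _ < _) _ in IH *.
have p : 0 < n.+2%:R :> R by rewrite ltr0n.
have e : n.+3%:R = n.+2%:R + 1 :> R by rewrite natr1.
rewrite e; move: p IH; set m : R := n.+2%:R => p IH.
have : (m + 1) ^- 2 <= m^-1 - (m + 1)^-1.
  have -> : m^-1 - (m + 1)^-1 = (m * (m + 1))^-1.
    by field; rewrite !lt0r_neq0 //; lra.
  rewrite lef_pV2 ?posrE; [nra|rewrite exprn_gt0 //; lra|rewrite mulr_gt0 //; lra].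
by move=> H; apply: le_trans (lerD IH H) _; rewrite addrA subrK.
Qed.

Definition coprime_pairs P Q := [set f : 'I_P * 'I_Q | coprime f.1.+1 f.2.+1].

(** At most [PQ] times the sum of [1 / d ^ 2] over [d >= 2] pairs have a common
    factor, and that sum is at most [3/4]. *)
Lemma card_coprime_pairs P Q : (P * Q <= 4 * #|coprime_pairs P Q|)%N.
Proof.
pose D (d : 'I_P.+2) : {set 'I_P * 'I_Q} :=
  if (1 < d)%N then [set f : 'I_P * 'I_Q | (d %| f.1.+1)%N && (d %| f.2.+1)%N] else set0.
have sub : ~: coprime_pairs P Q \subset \bigcup_d D d.
  apply/subsetP => -[i j]; rewrite !inE /= /coprime => ne.
  have gi : (gcdn i.+1 j.+1 < P.+2)%N.
    rewrite ltnS; apply: leq_trans (dvdn_leq _ (dvdn_gcdl _ _)) _ => //.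
    by rewrite ltnW // ltnS.
  apply/bigcupP; exists (Ordinal gi) => //; rewrite /D /=.
  by rewrite ltn_neqAle eq_sym ne gcdn_gt0 /= inE /= dvdn_gcdl dvdn_gcdr.
have c1 : (#|~: coprime_pairs P Q| <= \sum_(d : 'I_P.+2) #|D d|)%N.
  apply: leq_trans (subset_leq_card sub) _.
  elim/big_rec2 : _ => [|d s A _ le]; first by rewrite cards0.
  by apply: leq_trans (leq_card_setU _ _) _; rewrite leq_add2l.
have cD d : (#|D d|%:R : rat) <= if (1 < d)%N then (P * Q)%:R * d%:R ^- 2 else 0.
  rewrite /D; case: ifP => d1; last by rewrite cards0.
  have d0 : (0 < d)%N by exact: ltnW.
  have -> : [set f : 'I_P * 'I_Q | (d %| f.1.+1)%N && (d %| f.2.+1)%N] =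
      setX [set i : 'I_P | (d %| i.+1)%N] [set j : 'I_Q | (d %| j.+1)%N].
    by apply/setP => -[i j]; rewrite !inE.
  have dd : 0 < d%:R :> rat by rewrite ltr0n.
  have one n : (#|[set i : 'I_n | (d %| i.+1)%N]|%:R : rat) <= n%:R / d%:R.
    rewrite ler_pdivlMr // -natrM ler_nat.
    apply: leq_trans (leq_trunc_div n d); rewrite leq_mul2r card_multiples //.
    by rewrite orbT.
  rewrite cardsX !natrM; apply: le_trans (_ : P%:R / d%:R * (Q%:R / d%:R) <= _).
    by apply: ler_pM; rewrite ?ler0n.
  by rewrite le_eqVlt; apply/orP; left; apply/eqP; field; exact: lt0r_neq0.
have : (#|~: coprime_pairs P Q|%:R : rat) <= 3 / 4 * (P * Q)%:R.
  apply: le_trans (_ : \sum_(d : 'I_P.+2) #|D d|%:R <= _).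
    by rewrite -natr_sum ler_nat.
  apply: le_trans (ler_sum _ (fun d _ => cD d)) _.
  rewrite -big_mkcond /= -mulr_sumr mulrC; apply: ler_wpM2r; first exact: ler0n.
  apply: le_trans (sum_inv_sqr_le _ P); rewrite le_eqVlt; apply/orP; left; apply/eqP.
  rewrite -(big_mkord (fun d => 1 < d)%N (fun d => d%:R ^- 2)).
  rewrite (big_cat_nat (n := 2)) //= [X in X + _]big1_seq ?add0r; last first.
    by move=> d /andP[d1]; rewrite mem_index_iota; case: d d1 => [|[|]].
  by rewrite big_nat_cond [RHS]big_nat_cond; apply: eq_bigl => d; case: d => [|[|]].
have := cardsC (coprime_pairs P Q); rewrite card_prod !card_ord => <-.
rewrite natrD -(ler_nat rat) !natrM !natrD; lra.
Qed.

(** A lower bound on the denominator keeps the fractions [p / q] bounded by a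
    multiple of [P / Q]. *)
Definition large_coprime_pairs P Q :=
  [set f : 'I_P * 'I_Q | coprime f.1.+1 f.2.+1 && (Q < 8 * f.2.+1)%N].

Lemma card_large_coprime_pairs P Q : (P * Q <= 8 * #|large_coprime_pairs P Q|)%N.
Proof.
pose S := [set f : 'I_P * 'I_Q | (8 * f.2.+1 <= Q)%N].
have cS : (8 * #|S| <= P * Q)%N.
  have -> : S = setX setT [set j : 'I_Q | (8 * j.+1 <= Q)%N].
    by apply/setP => -[i j]; rewrite !inE.
  rewrite cardsX cardsT card_ord mulnCA leq_mul2l; apply/orP; right.
  apply: leq_trans (leq_trunc_div Q 8); rewrite mulnC leq_mul2r /=.
  case E : (Q %/ 8)%N => [|k].
    rewrite leqn0 cards_eq0; apply/eqP/setP => j; rewrite !inE; apply/negP.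
    by move=> /(leq_div2r 8); rewrite E mulKn.
  rewrite -(card_in_imset (f := fun j : 'I_Q => inord j : 'I_k.+1)).
    by apply: leq_trans (max_card _) _; rewrite card_ord.
  have lt (j : 'I_Q) : (8 * j.+1 <= Q)%N -> (j < k.+1)%N.
    by move=> /(leq_div2r 8); rewrite E mulKn.
  move=> i j; rewrite !inE => hi hj /(congr1 val) /=; rewrite !inordK ?lt // => e.
  exact: val_inj.
have sub : coprime_pairs P Q \subset large_coprime_pairs P Q :|: S.
  by apply/subsetP => f; rewrite !inE => ->; rewrite /= ltnNge orNb.
have := leq_trans (subset_leq_card sub) (leq_card_setU _ _).
have := card_coprime_pairs P Q; move: cS; lia.
Qed.

Lemma coprime_fraction_gap (R : realFieldType) (p q p' q' Q : nat) :
  coprime p q -> coprime p' q' -> (0 < q <= Q)%N -> (0 < q' <= Q)%N ->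
  (p, q) != (p', q') -> Q%:R ^- 2 <= `|p%:R / q%:R - p'%:R / q'%:R| :> R.
Proof.
move=> cpq cpq' /andP[q0 qQ] /andP[q0' qQ'] ne.
have r0 : 0 < q%:R :> R by rewrite ltr0n.
have r0' : 0 < q'%:R :> R by rewrite ltr0n.
have ne' : (p * q' != p' * q)%N.
  apply: contra ne => /eqP e; apply/eqP.
  have d1 : (q %| q')%N.
    by rewrite -(Gauss_dvdr (m := q) (n := p)) 1?coprime_sym // e dvdn_mull.
  have d2 : (q' %| q)%N.
    by rewrite -(Gauss_dvdr (m := q') (n := p')) 1?coprime_sym // -e dvdn_mull.
  have eqq : q = q' by apply/eqP; rewrite eqn_dvd d1.
  by move: e; rewrite eqq => /eqP; rewrite eqn_pmul2r // => /eqP ->.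
have -> : p%:R / q%:R - p'%:R / q'%:R = (p%:R * q'%:R - p'%:R * q%:R) / (q%:R * q'%:R) :> R.
  by field; rewrite !lt0r_neq0.
have qq0 : 0 < q%:R * q'%:R :> R by rewrite mulr_gt0.
rewrite normrM normfV (gtr0_norm qq0) ler_pdivlMr //.
apply: le_trans (_ : 1 <= _).
  rewrite mulrC ler_pdivrMr ?exprn_gt0 ?ltr0n ?(leq_trans q0) // mul1r expr2.
  by apply: ler_pM; rewrite ?ler0n ?ler_nat.
have key (m n : nat) : (m < n)%N -> 1 <= `|m%:R - n%:R| :> R.
  move=> mn; rewrite distrC ger0_norm ?subr_ge0 ?ler_nat 1?ltnW //.
  by rewrite lerBrDr addrC natr1 ler_nat.
rewrite -!natrM; case: (ltngtP (p * q') (p' * q))%N ne' => [/key|/key|->] //.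
by rewrite distrC.
Qed.

From mathcomp Require Import classical_sets.
Local Open Scope classical_set_scope.
Local Open Scope ring_scope.

(** * Covering numbers and Hausdorff content in the plane *)

Section Plane.
Variable R : realType.
Implicit Types (p e : 'rV[R]_2) (A : set 'rV[R]_2).

Lemma dotpE p e : dotp p e = p 0 0 * e 0 0 + p 0 1 * e 0 1.
Proof.
rewrite /dotp big_ord_recl big_ord1.
by have -> : lift ord0 ord0 = 1 :> 'I_2 by exact: val_inj.
Qed.

Lemma dotpp_ge0 p : 0 <= dotp p p.
Proof. by rewrite dotpE; apply: addr_ge0; rewrite -expr2 sqr_ge0. Qed.

Lemma enorm_ge0 p : 0 <= enorm p.
Proof. exact: sqrtr_ge0. Qed.

Lemma sqr_enorm p : enorm p ^+ 2 = p 0 0 ^+ 2 + p 0 1 ^+ 2.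
Proof. by rewrite sqr_sqrtr ?dotpp_ge0 // dotpE !expr2. Qed.

Lemma enorm_le p (t : R) : 0 <= t -> (enorm p <= t) = (p 0 0 ^+ 2 + p 0 1 ^+ 2 <= t ^+ 2).
Proof. by move=> t0; rewrite -sqr_enorm ler_pXn2r ?nnegrE ?enorm_ge0. Qed.

Lemma coord0_le_enorm p : `|p 0 0| <= enorm p.
Proof.
rewrite -(@ler_pXn2r _ 2) ?nnegrE ?enorm_ge0 // sqr_enorm real_normK ?num_real //.
by rewrite lerDl sqr_ge0.
Qed.

Lemma coord1_le_enorm p : `|p 0 1| <= enorm p.
Proof.
rewrite -(@ler_pXn2r _ 2) ?nnegrE ?enorm_ge0 // sqr_enorm real_normK ?num_real //.
by rewrite lerDr sqr_ge0.
Qed.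

Lemma enorm_le_coords p (a b : R) : `|p 0 0| <= a -> `|p 0 1| <= b -> enorm p <= a + b.
Proof.
move=> ha hb.
have a0 := le_trans (normr_ge0 _) ha; have b0 := le_trans (normr_ge0 _) hb.
rewrite enorm_le ?addr_ge0 // -(real_normK (num_real (p 0 0))) -(real_normK (num_real (p 0 1))).
have : `|p 0 0| ^+ 2 <= a ^+ 2 by rewrite ler_pXn2r ?nnegrE.
have : `|p 0 1| ^+ 2 <= b ^+ 2 by rewrite ler_pXn2r ?nnegrE.
have : 0 <= a * b by rewrite mulr_ge0.
nra.
Qed.

Lemma dotp_unit p e : enorm e = 1 -> `|dotp p e| <= enorm p.
Proof.
move=> e1; have := sqr_enorm e; rewrite e1 expr1n => he.
rewrite -(@ler_pXn2r _ 2) ?nnegrE ?enorm_ge0 // sqr_enorm real_normK ?num_real // dotpE.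
have := sqr_ge0 (p 0 0 * e 0 1 - p 0 1 * e 0 0) => h.
have -> : p 0 0 ^+ 2 + p 0 1 ^+ 2 = (p 0 0 ^+ 2 + p 0 1 ^+ 2) * (e 0 0 ^+ 2 + e 0 1 ^+ 2).
  by rewrite -he mulr1.
by nra.
Qed.

(** The infimum is attained since it is taken over natural numbers. *)
Lemma covering_number_leP A (rho t : R) : (covering_number A rho <= t%:E)%E ->
  exists n (z : 'I_n -> 'rV[R]_2), n%:R <= t /\ A `<=` \bigcup_i eball (z i) rho.
Proof.
move=> le.
pose Q n := `[<exists z : 'I_n -> 'rV[R]_2, A `<=` \bigcup_i eball (z i) rho>].
have [exQ|nQ] := pselect (exists n, Q n); last first.
  move: le; rewrite /covering_number (_ : [set n | _] = set0).
    by rewrite image_set0 ereal_inf0 leye_eq.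
  by apply/seteqP; split=> // n /= [z hz]; apply: nQ; exists n; apply/asboolP; exists z.
case: (ex_minnP exQ) => n /asboolP[z hz] minn.
exists n, z; split=> //; rewrite -lee_fin; apply: le_trans le.
apply: le_ereal_inf_tmp => _ [m /= hm <-]; rewrite lee_fin ler_nat; apply: minn.
exact/asboolP.
Qed.

Lemma covering_number_le A (rho : R) n (z : 'I_n -> 'rV[R]_2) :
  A `<=` \bigcup_i eball (z i) rho -> (covering_number A rho <= n%:R%:E)%E.
Proof. by move=> hz; apply: ereal_inf_lbound; exists n => //; exists z. Qed.

(** A maximal [r]-separated subset is the set of centres of a cover. *)
Lemma covering_number_le_separated A (r t : R) : 0 <= t ->
  (forall m (f : 'I_m -> 'rV[R]_2), (forall i, A (f i)) ->
    (forall i j, i != j -> r < enorm (f i - f j)) -> m%:R <= t) ->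
  (covering_number A r <= t%:E)%E.
Proof.
move=> t0 sep.
pose Q m := `[<exists f : 'I_m -> 'rV[R]_2, (forall i, A (f i)) /\
    (forall i j, i != j -> r < enorm (f i - f j))>].
have exQ : exists m, Q m.
  by exists 0%N; apply/asboolP; exists (fun=> 0); split; case.
have ubQ m : Q m -> (m <= Num.trunc t)%N.
  by move=> /asboolP[f [fA fs]]; rewrite truncn_ge_nat //; exact: sep fs.
case: (ex_maxnP exQ ubQ) => m /asboolP[f [fA fs]] maxm.
apply: le_trans (_ : (m%:R%:E <= _)%E); last by rewrite lee_fin; exact: sep fs.
apply: (@covering_number_le _ _ _ f) => p Ap; apply: contrapT => np.
have far i : r < enorm (p - f i).
  by rewrite ltNge; apply/negP => le; apply: np; exists i.
have esym (a b : 'rV[R]_2) : enorm (a - b) = enorm (b - a).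
  by rewrite /enorm !dotpE !mxE; congr Num.sqrt; ring.
suff : Q m.+1 by move=> /maxm; rewrite ltnn.
apply/asboolP; exists (fun i => if unlift ord0 i is Some j then f j else p).
split=> [i|i j]; first by case: unliftP.
case: (unliftP ord0 i) => [i' ->|->]; case: (unliftP ord0 j) => [j' ->|->] ne.
- by apply: fs; apply/eqP => e; move/eqP: ne; rewrite e.
- by rewrite esym.
- exact: far.
- by rewrite eqxx in ne.
Qed.

Lemma diam_le A (d : R) : 0 <= d ->
  (forall p q, A p -> A q -> enorm (p - q) <= d) -> (diam A <= d%:E)%E.
Proof.
move=> d0 h; apply: ge_ereal_sup => _ [->|[p [q [Ap Aq ->]]]]; by rewrite lee_fin ?h.
Qed.

Lemma diam_ge0 A : (0 <= diam A)%E.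
Proof. by apply: ereal_sup_ubound; left. Qed.

Lemma content_le_sum A (T : finType) (F : T -> set 'rV[R]_2) (d : T -> R) :
  A `<=` \bigcup_t F t -> (forall t, (diam (F t) <= (d t)%:E)%E) ->
  (hausdorff_content1 A <= (\sum_t d t)%:E)%E.
Proof.
move=> AF dF.
pose E i := if insub i is Some j then F (enum_val (j : 'I_#|T|)) else set0.
have E0 i : (#|T| <= i)%N -> diam (E i) = 0%E.
  move=> le; apply/eqP; rewrite eq_le diam_ge0 andbT /E insubN -?leqNgt //.
  exact: diam_le.
apply: le_trans (_ : (\sum_(0 <= i <oo) diam (E i) <= _)%E).
  apply: ereal_inf_lbound; exists E => // p /AF[t _ Ft]; exists (enum_rank t) => //.
  by rewrite /E valK enum_rankK.
rewrite (nneseries_split 0 #|T|) => [|k _]; last exact: diam_ge0.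
rewrite add0n [X in (_ + X)%E]eseries0 ?adde0 => [|k le _]; last exact: E0.
rewrite big_mkord -sumEFin (reindex (@enum_val T T)) /=; last first.
  exact/onW_bij/enum_val_bij.
apply: lee_sum => j _; by rewrite /E valK dF.
Qed.
End Plane.

(** Numbers the values of [f] by their first position in [l]. *)
Lemma index_code (I : finType) (f : I -> int) (l : seq int) (B : nat) : (0 < B)%N ->
  (size l <= B)%N -> (forall i, f i \in l) ->
  exists b : I -> 'I_B, forall i k, b i = b k <-> f i = f k.
Proof.
move=> B0 lB fl.
have lt i : (index (f i) l < B)%N by apply: leq_trans lB; rewrite index_mem.
exists (fun i => Ordinal (lt i)) => i k; split=> [[e]|e].
  by rewrite -(nth_index 0 (fl i)) e nth_index.
by apply: val_inj; rewrite /= e.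
Qed.

(** On a quarter circle [a] and [b] vary in opposite directions, so [a - b] is a
    coordinate comparable to both the chord and the sine of the angle. *)
Lemma quarter_circle (R : realFieldType) (a b a' b' : R) :
  0 <= a -> 0 <= b -> 0 <= a' -> 0 <= b' ->
  a ^+ 2 + b ^+ 2 = 1 -> a' ^+ 2 + b' ^+ 2 = 1 ->
  [/\ (a - a') ^+ 2 + (b - b') ^+ 2 <= ((a - b) - (a' - b')) ^+ 2,
      `|(a - b) - (a' - b')| <= 2 * `|a * b' - b * a'| & -1 <= a - b <= 1].
Proof.
move=> a0 b0 a0' b0' e e'.
have le1 (u v : R) : 0 <= u -> 0 <= v -> u ^+ 2 + v ^+ 2 = 1 -> u <= 1.
  move=> u0 v0 h; rewrite -(@ler_pXn2r _ 2) ?nnegrE // expr1n.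
  by have := sqr_ge0 v; lra.
have a1 := le1 _ _ a0 b0 e; have b1 : b <= 1 by apply: (le1 b a) => //; lra.
have mono (u v u' v' : R) : 0 <= u -> 0 <= v -> 0 <= u' -> 0 <= v' ->
    u ^+ 2 + v ^+ 2 = 1 -> u' ^+ 2 + v' ^+ 2 = 1 -> u <= u' -> v' <= v.
  move=> u0 v0 u0' v0' h h' le; rewrite -(@ler_pXn2r _ 2) ?nnegrE //.
  have : u ^+ 2 <= u' ^+ 2 by rewrite ler_pXn2r ?nnegrE.
  lra.
have neg : (a - a') * (b - b') <= 0.
  case: (leP a a') => [le|/ltW le].
    have := mono _ _ _ _ a0 b0 a0' b0' e e' le; nra.
  have := mono _ _ _ _ a0' b0' a0 b0 e' e le; nra.
split; last by apply/andP; split; lra.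
- nra.
- rewrite -[X in _ <= X * _]ger0_norm // -normrM -(@ler_pXn2r _ 2) ?nnegrE ?normr_ge0 //.
  rewrite !real_normK ?num_real //.
  pose D := a * a' + b * b'; have D0 : 0 <= D by rewrite /D addr_ge0 ?mulr_ge0.
  have D1 : D <= 1.
    by rewrite /D; have := sqr_ge0 (a - a'); have := sqr_ge0 (b - b'); nra.
  have dd : (a * b' - b * a') ^+ 2 = 1 - D ^+ 2.
    rewrite /D; transitivity ((a ^+ 2 + b ^+ 2) * (a' ^+ 2 + b' ^+ 2) - (a * a' + b * b') ^+ 2).
      by ring.
    by rewrite e e' mulr1.
  have s : (a - a') ^+ 2 + (b - b') ^+ 2 = 2 - 2 * D by rewrite /D; nra.
  rewrite exprMn dd; have := sqr_ge0 ((a - a') + (b - b')) => h; nra.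
Qed.

(** * The upper bound *)

Section FrostmanPoints.
Variables (R : realType) (K : set 'rV[R]_2) (n : nat).
Hypothesis K1 : K `<=` eball 0 1.

Lemma coord_bounds p : K p -> -1 <= p 0 0 <= 1 /\ -1 <= p 0 1 <= 1.
Proof.
move=> /K1; rewrite /eball /= subr0 => le.
by rewrite -!ler_norml; split; apply: le_trans le; [exact: coord0_le_enorm|exact: coord1_le_enorm].
Qed.

Let L := (2 * 2 ^ n)%N.
Definition grid (t : R) : nat := Num.trunc ((t + 1) * 2 ^+ n).
Definition cell_of (p : 'rV[R]_2) : 'I_L.+1 * 'I_L.+1 :=
  (inord (grid (p 0 0)), inord (grid (p 0 1))).

Lemma gridP t : -1 <= t -> (grid t)%:R <= (t + 1) * 2 ^+ n < (grid t).+1%:R.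
Proof. by move=> t1; apply: truncn_itv; rewrite mulr_ge0 ?exprn_ge0 //; lra. Qed.

Lemma grid_lt t : t <= 1 -> (grid t < L.+1)%N.
Proof.
move=> t1; rewrite ltnS /grid -[X in (_ <= X)%N](@natrK R _); apply: le_truncn.
by rewrite /L natrM natrX ler_pM2r ?exprn_gt0 //; lra.
Qed.

Lemma cell_ofE p : K p -> (cell_of p).1 = grid (p 0 0) :> nat /\ (cell_of p).2 = grid (p 0 1) :> nat.
Proof.
by move=> /coord_bounds[/andP[_ h1] /andP[_ h2]]; rewrite /= !inordK ?grid_lt.
Qed.

Lemma grid_close (t t' : R) l : -1 <= t -> -1 <= t' ->
  (grid t %/ 2 ^ l = grid t' %/ 2 ^ l)%N -> `|t - t'| <= 2 ^+ l / 2 ^+ n.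
Proof.
have key a b : -1 <= a -> -1 <= b -> (grid a %/ 2 ^ l = grid b %/ 2 ^ l)%N ->
    a - b <= 2 ^+ l / 2 ^+ n.
  move=> /gridP/andP[_ h1] /gridP/andP[h2 _] e.
  rewrite ler_pdivlMr ?exprn_gt0 //.
  have : (grid a < grid b + 2 ^ l)%N.
    rewrite (divn_eq (grid a) (2 ^ l)) (divn_eq (grid b) (2 ^ l)) e -addnA ltn_add2l.
    by rewrite ltn_addl // ltn_pmod // expn_gt0.
  by rewrite -(ler_nat R) natrD natrX; lra.
move=> h h' e; rewrite ler_norml; apply/andP; split; last exact: key.
by have := key _ _ h' h (esym e); lra.
Qed.

(** [frostman_cover], applied to the cells of side [2 ^- n] that meet [K]: the full
    cells cover [K], hence their total diameter is at least the content. *)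
Lemma frostman_points (c : R) : (c%:E <= hausdorff_content1 K)%E ->
  exists (I : finType) (f : I -> 'rV[R]_2) (u v : I -> nat),
  [/\ forall i, K (f i),
      forall i, (u i)%:R <= (f i 0 0 + 1) * 2 ^+ n < (u i).+1%:R,
      forall i, (v i)%:R <= (f i 0 1 + 1) * 2 ^+ n < (v i).+1%:R,
      forall i k, f i 0 0 = f k 0 0 -> f i 0 1 = f k 0 1 -> i = k &
      (forall m i, (m <= n.+1)%N -> (mass u v [set: I]%SET m i <= 2 ^ m)%N) /\
      c * 2 ^+ n <= 2 * #|I|%:R].
Proof.
move=> cK.
pose T : finType := ('I_L.+1 * 'I_L.+1)%type.
pose X : {set T} := [set t : T | `[<exists2 p, K p & cell_of p = t>]]%SET.
have /choice[pt ptP] : forall t, exists p : 'rV[R]_2, t \in X -> K p /\ cell_of p = t.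
  move=> t; have [[p Kp e]|no] := pselect (exists2 p, K p & cell_of p = t).
    by exists p.
  by exists 0; rewrite inE => /asboolP.
pose ut (t : T) : nat := t.1; pose vt (t : T) : nat := t.2.
have [P [Y [lev [PX massP cov tot]]]] := frostman_cover ut vt X n.+1.
have PK t : t \in P -> K (pt t) /\ cell_of (pt t) = t.
  by move=> tP; apply: ptP; exact: (fintype.subsetP PX).
exists {t : T | t \in P}, (fun i => pt (val i)), (fun i => ut (val i)), (fun i => vt (val i)).
have posu (i : {t : T | t \in P}) : ut (val i) = grid (pt (val i) 0 0) /\ vt (val i) = grid (pt (val i) 0 1).
  have [Kp e] := PK _ (valP i); rewrite -{1 3}e /ut /vt; exact: cell_ofE.
split.
- by move=> i; have [] := PK _ (valP i).
- move=> i; have [-> _] := posu i; apply: gridP.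
  by have [/coord_bounds[/andP[]]] := PK _ (valP i).
- move=> i; have [_ ->] := posu i; apply: gridP.
  by have [/coord_bounds[_ /andP[]]] := PK _ (valP i).
- move=> i k e1 e2; apply: val_inj.
  have [_ <-] := PK _ (valP i); have [_ <-] := PK _ (valP k).
  by rewrite /cell_of e1 e2.
split.
  move=> m i mn; apply: leq_trans (massP m (val i) mn).
  rewrite /mass -(card_imset _ val_inj); apply: subset_leq_card; apply/fintype.subsetP => t.
  by move=> /imsetP[k]; rewrite !inE /= => sk ->; rewrite (valP k).
pose F t := [set p | [/\ K p, t \in Y & same_cell ut vt (lev t) t (cell_of p)]].
pose d t : R := if t \in Y then 2 * (2 ^+ lev t / 2 ^+ n) else 0.
have p2 : 0 < 2 ^+ n :> R by rewrite exprn_gt0.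
have : (hausdorff_content1 K <= (\sum_t d t)%:E)%E.
  apply: (content_le_sum (F := F)) => [p Kp|t].
    have cX : cell_of p \in X by rewrite inE; apply/asboolP; exists p.
    by have [t tY st] := cov _ cX; exists t.
  apply: diam_le.
    by rewrite /d; case: ifP => // _; rewrite mulr_ge0 // divr_ge0 ?exprn_ge0.
  move=> p q [Kp tY sp] [Kq _ sq]; rewrite /d tY.
  have /andP[/eqP e1 /eqP e2] : same_cell ut vt (lev t) (cell_of p) (cell_of q).
    by apply: same_cell_trans sq; rewrite same_cell_sym.
  have [p1 pp2] := cell_ofE Kp; have [q1 q2] := cell_ofE Kq.
  have [/andP[a1 _] /andP[a2 _]] := coord_bounds Kp.
  have [/andP[a3 _] /andP[a4 _]] := coord_bounds Kq.
  rewrite (_ : 2 * (2 ^+ lev t / 2 ^+ n) = 2 ^+ lev t / 2 ^+ n + 2 ^+ lev t / 2 ^+ n); last by lra.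
  apply: enorm_le_coords; rewrite !mxE.
    by apply: grid_close => //; rewrite -p1 -q1.
  by apply: grid_close => //; rewrite -pp2 -q2.
move=> /(le_trans cK); rewrite lee_fin -big_mkcond /= => le.
rewrite card_sig (_ : #|[pred x in P]| = #|P|); last by apply: eq_card => t; rewrite inE.
apply: le_trans (_ : 2 * (\sum_(y in Y) 2 ^ lev y)%:R <= _); last by rewrite ler_pM2l // ler_nat.
rewrite -ler_pdivlMr //; apply: le_trans le _.
rewrite natr_sum mulr_sumr mulr_suml; apply: ler_sum => t _.
by rewrite natrX mulrA.
Qed.
End FrostmanPoints.

Section UpperBound.
Variable R : realType.

(** The least [n] with [2 ^- n <= delta]. *)
Lemma dyadic_scale (delta : R) : 0 < delta -> delta <= 1 / 2 ->
  exists n, [/\ 1 <= delta * 2 ^+ n, delta * 2 ^+ n <= 2 &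
    n.+2%:R * ln 2 <= 4 * ln (1 / delta)].
Proof.
move=> d0 d2.
have ex : exists n, 1 <= delta * 2 ^+ n.
  exists (Num.trunc (1 / delta)).+1.
  have q0 : 0 <= 1 / delta by rewrite divr_ge0 // ltW.
  have /andP[_ h] := truncn_itv q0.
  rewrite -ler_pdivrMl // mulrC; apply: le_trans (ltW h) _.
  by rewrite -natrX ler_nat ltnW // ltn_expl.
case: (ex_minnP ex) => n hn minn; exists n.
have ln20 : 0 < ln (2 : R) by rewrite ln_gt0 // ltr1n.
have lnd : ln 2 <= ln (1 / delta).
  rewrite ler_ln ?posrE ?divr_gt0 //; rewrite ler_pdivlMr //; lra.
case: n hn minn => [|n] hn minn.
  by split=> //; [move: hn; rewrite expr0; lra|move: hn; rewrite expr0; lra].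
have lt : delta * 2 ^+ n < 1 by rewrite ltNge; apply/negP => /minn; rewrite ltnn.
split=> //; first by rewrite exprS; lra.
have : ln (2 ^+ n) <= ln (1 / delta).
  rewrite ler_ln ?posrE ?divr_gt0 ?exprn_gt0 // ler_pdivlMr //; lra.
rewrite lnXn // -[ln 2 *+ _]mulr_natl => h.
have -> : n.+3%:R = n%:R + 3 :> R by rewrite -[n.+3]addn3 natrD.
rewrite mulrDl.
lra.
Qed.

(** The signs [s1] and [s2] select the quarter of the circle; a tube of width
    [2 delta] is a value of [bucket], and an interval of length [2 delta] meets at
    most two of them, which turns the cover of the projection into [b]. *)
Lemma quarter_bound (K : set 'rV[R]_2) (c M h delta r : R) (J : finType)
    (e : J -> 'rV[R]_2) (s1 s2 : bool) :
  K `<=` eball 0 1 -> (c%:E <= hausdorff_content1 K)%E -> 0 < c ->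
  0 < delta -> delta <= 1 / 2 -> delta <= r -> r <= 1 ->
  0 < M -> 1 <= M ^+ 2 * delta -> 0 < h -> h ^+ 2 = delta / r ->
  (forall j, small_proj_dirs K delta M (e j)) ->
  (forall i j, i != j -> r < enorm (e i - e j)) ->
  (forall j, 0 <= (-1) ^+ s1 * e j 0 0) -> (forall j, 0 <= (-1) ^+ s2 * e j 0 1) ->
  #|J|%:R <= 512 * (5040 * ln (1 / delta) / ln 2 / Num.min 1 (c / 2)) * M * h /\
  #|J|%:R * r <= 3.
Proof.
move=> K1 cK c0 d0 d2 dr r1 M0 M2 h0 h2 eE esep es1 es2.
have r0 : 0 < r by apply: lt_le_trans dr.
have [n [n1 n2 nln]] := dyadic_scale d0 d2.
have [I [f [u [v [fK uP vP finj [cells cI]]]]]] := frostman_points n K1 cK.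
pose x i := f i 0 0; pose y i := f i 0 1.
pose cc j := e j 0 0; pose ss j := e j 0 1.
have unit_dir j : cc j ^+ 2 + ss j ^+ 2 = 1.
  by have [eu _] := eE j; rewrite -sqr_enorm eu expr1n.
pose phi j := (-1) ^+ s1 * cc j - (-1) ^+ s2 * ss j.
have sq (b : bool) (t : R) : ((-1) ^+ b * t) ^+ 2 = t ^+ 2.
  by rewrite exprMn -exprM mulnC exprM sqrrN !expr1n mul1r.
have qc j k := @quarter_circle R ((-1) ^+ s1 * cc j) ((-1) ^+ s2 * ss j)
  ((-1) ^+ s1 * cc k) ((-1) ^+ s2 * ss k) (es1 j) (es2 j) (es1 k) (es2 k).
have {}qc j k := qc j k (etrans (congr2 +%R (sq _ _) (sq _ _)) (unit_dir j))
  (etrans (congr2 +%R (sq _ _) (sq _ _)) (unit_dir k)).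
have phi_sep j k : j != k -> r < `|phi j - phi k|.
  move=> ne; have [le _ _] := qc j k.
  apply: lt_le_trans (esep _ _ ne) _.
  rewrite enorm_le ?normr_ge0 // real_normK ?num_real // !mxE.
  by move: le; rewrite -!mulrBr !sq.
have phi_lip j k : `|phi j - phi k| <= 2 * `|det cc ss j k|.
  have [_ le _] := qc j k; apply: le_trans le _.
  have -> : (-1) ^+ s1 * cc j * ((-1) ^+ s2 * ss k) - (-1) ^+ s2 * ss j * ((-1) ^+ s1 * cc k)
    = (-1) ^+ s1 * ((-1) ^+ s2 * det cc ss j k) by rewrite /det; ring.
  by rewrite !normrMsign.
have phi_rng j : -1 <= phi j <= 1 by have [] := qc j j.
split; last exact: (card_dirs r0 r1 phi_sep phi_rng).
have M1 : 1 <= M.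
  have : 1 <= M ^+ 2 by apply: le_trans M2 _; rewrite ler_piMr ?sqr_ge0 //; lra.
  by rewrite -{1}(expr1n _ 2) ler_pXn2r ?nnegrE ?(ltW M0).
pose B := (2 * Num.trunc M)%N.
have B0 : (0 < B)%N by rewrite muln_gt0 /= truncn_gt0.
have BM : B%:R <= 2 * M.
  by rewrite natrM ler_pM2l //; have /andP[] := truncn_itv (ltW M0).
have /choice[b bP] : forall j, exists b : I -> 'I_B, forall i k,
    b i = b k <-> bucket x y cc ss delta j i = bucket x y cc ss delta j k.
  move=> j; have [eu /covering_number_leP[m [z [mM zc]]]] := eE j.
  pose a k := Num.floor ((dotp (z k) (e j) - delta) / (2 * delta)).
  apply: (index_code (l := codom a ++ codom (fun k => a k + 1))) => //.
    rewrite size_cat !size_codom card_ord addnn -muln2 mulnC leq_mul2l /=.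
    by rewrite truncn_ge_nat // ltW.
  move=> i; rewrite mem_cat.
  have [k _ kb] : (\bigcup_k eball (z k) delta) (orthoproj (e j) (f i)).
    by apply: zc; exists (f i).
  have pe : dotp (f i) (e j) = proj x y cc ss j i.
    by rewrite dotpE /proj /x /y /cc /ss; ring.
  have : `|proj x y cc ss j i - dotp (z k) (e j)| <= delta.
    apply: le_trans kb; apply: le_trans (dotp_unit _ eu); rewrite -pe.
    rewrite [X in _ <= `|X|]dotpE /orthoproj !mxE.
    have := sqr_enorm (e j); rewrite eu expr1n => hu.
    rewrite [dotp (z k) _]dotpE; rewrite le_eqVlt; apply/orP; left; apply/eqP; congr `|_|.
    rewrite -[X in X - _ = _]mulr1 {1}hu; ring.
  rewrite ler_norml => /andP[h1 h3].
  have dd0 : 0 < 2 * delta by rewrite mulr_gt0.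
  pose w := (dotp (z k) (e j) - delta) / (2 * delta).
  pose q := proj x y cc ss j i / (2 * delta).
  have wq : w <= q by rewrite /w /q ler_pM2r ?invr_gt0 //; lra.
  have qw : q <= w + 1.
    rewrite /w /q -[X in _ + X](divff (lt0r_neq0 dd0)) -mulrDl ler_pM2r ?invr_gt0 //; lra.
  have f1 : Num.floor w <= Num.floor q by exact: le_floor.
  have f2 : Num.floor q <= Num.floor w + 1.
    have /andP[_ hw] := floor_itv w; have /andP[hq _] := floor_itv q.
    have : (Num.floor q)%:~R < (Num.floor w + 1 + 1)%:~R :> R.
      by rewrite intrD; lra.
    by rewrite ltr_int ltzD1.
  rewrite -[bucket _ _ _ _ _ _ _]/(Num.floor q).
  have [->|->] : Num.floor q = Num.floor w \/ Num.floor q = Num.floor w + 1.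
    move: f1; rewrite le_eqVlt => /orP[/eqP ->|]; first by left.
    by rewrite -lezD1 => f1; right; apply: le_anti; rewrite f1 f2.
  - by apply/orP; left; exact: (codom_f a k).
  - by apply/orP; right; exact: (codom_f (fun k => a k + 1) k).
pose kappa := Num.min 1 (c / 2).
have k0 : 0 < kappa by rewrite lt_min ltr01 divr_gt0.
have k1 : kappa <= 1 by rewrite ge_min lexx.
have kI : kappa <= delta * #|I|%:R.
  apply: le_trans (_ : c / 2 <= _); first by rewrite ge_min lexx orbT.
  have : c <= c * (delta * 2 ^+ n) by rewrite ler_peMr // ltW.
  rewrite mulrCA; have := ler_wpM2l (ltW d0) cI; lra.
have h1 : h <= 1.
  rewrite -(@ler_pXn2r _ 2) ?nnegrE ?(ltW h0) // h2 expr1n ler_pdivrMr // mul1r //.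
have en i := energy_bound d0 n2 (fun i => proj1 (coord_bounds K1 (fK i)))
  (fun i => proj2 (coord_bounds K1 (fK i))) uP vP cells i.
have {}en i : \sum_(k | k != i) Num.min 3 (35 * delta / sup_dist x y i k) <= 1260 * n.+2%:R.
  by apply: en => k ne; apply: sup_dist_gt0 => //; rewrite eq_sym.
have L1 : 1 <= 1260 * n.+2%:R :> R by rewrite -natrM ler1n.
have main := card_directions unit_dir d0 r0 r1 phi_sep phi_lip phi_rng finj bP en L1
  k0 k1 kI BM M2 M0 h0 h2 h1.
have l2 : 0 < ln (2 : R) by rewrite ln_gt0 // ltr1n.
have Lle : 1260 * n.+2%:R <= 5040 * ln (1 / delta) / ln 2.
  by rewrite ler_pdivlMr //; lra.
apply: (le_trans main); apply: ler_wpM2r; first exact: ltW.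
apply: ler_wpM2r; first exact: ltW.
apply: (ler_wpM2l (ler0n R 512)); apply: ler_wpM2r Lle.
by rewrite invr_ge0 ltW.
Qed.
End UpperBound.

Section Scale.
Variables (R : realType) (s delta : R).
Hypotheses (s2 : 1 / 2 <= s) (s1 : s < 1) (d0 : 0 < delta) (d2 : delta <= 1 / 2).

Lemma powRN_sqr_ge : 1 <= (delta `^ (- s)) ^+ 2 * delta.
Proof.
have dn : delta != 0 by exact: lt0r_neq0.
have d01 : 0 < delta <= 1 by rewrite d0 /=; have := d2; lra.
have -> : (delta `^ (- s)) ^+ 2 * delta = delta `^ (- s + - s + 1).
  by rewrite !powRD ?dn ?implybT // powRr1 ?ltW // expr2.
rewrite -[X in X <= _](powRr0 delta); apply: (ger_powR d01); have := s2; have := s1; lra.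
Qed.

Lemma powRN_mul_rad_le r : r <= delta `^ s -> r * delta `^ (- s) <= 1.
Proof.
move=> rs; rewrite powRN -ler_pdivlMr ?invr_gt0 ?powR_gt0 //.
by rewrite invrK mul1r.
Qed.

Lemma powR_half_gt0 r : 0 < r -> 0 < (delta / r) `^ (1 / 2).
Proof. by move=> r0; rewrite powR_gt0 // divr_gt0. Qed.

Lemma powR_half_sqr r : 0 < r -> ((delta / r) `^ (1 / 2)) ^+ 2 = delta / r.
Proof.
move=> r0; have q0 : 0 <= delta / r by rewrite ltW // divr_gt0.
by rewrite mul1r powR12_sqrt // sqr_sqrtr.
Qed.
End Scale.

Lemma upper_bound (R : realType) (c : R) : 0 < c ->
  exists2 C : R, 1 <= C &
    forall (K : set 'rV[R]_2) (s delta r : R),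
      K `<=` eball 0 1 -> (c%:E <= hausdorff_content1 K)%E ->
      1 / 2 <= s -> s < 1 -> 0 < delta -> delta <= 1 / 2 -> delta <= r -> r <= 1 ->
      (covering_number (small_proj_dirs K delta (delta `^ (- s))) r
        <= (C * ln (1 / delta) *
            Num.min (delta `^ (- s) * (delta / r) `^ (1 / 2)) (1 / r))%:E)%E.
Proof.
move=> c0.
have l2 : 0 < ln (2 : R) by rewrite ln_gt0 // ltr1n.
pose kappa : R := Num.min 1 (c / 2).
have k0 : 0 < kappa by rewrite lt_min ltr01 divr_gt0.
pose Q : R := 5040 / ln 2 / kappa.
pose C1 : R := 4 * 512 * Q; pose C2 : R := 12 / ln 2.
have Q0 : 0 <= Q := divr_ge0 (divr_ge0 (ler0n R 5040) (ltW l2)) (ltW k0).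
have C10 : 0 <= C1 := mulr_ge0 (mulr_ge0 (ler0n R 4) (ler0n R 512)) Q0.
have C20 : 0 <= C2 := divr_ge0 (ler0n R 12) (ltW l2).
exists (1 + C1 + C2); first by lra.
move=> K s delta r K1 cK s2 s1 d0 d2 dr r1.
have r0 : 0 < r by apply: lt_le_trans dr.
set M := delta `^ (- s); set h := (delta / r) `^ (1 / 2); set l := ln (1 / delta).
have M0 : 0 < M by rewrite powR_gt0.
have h0 : 0 < h by exact: powR_half_gt0.
have lnd : ln 2 <= l.
  rewrite ler_ln ?posrE ?divr_gt0 //; rewrite ler_pdivlMr //; lra.
have l0 : 0 < l by apply: lt_le_trans lnd.
have Mh0 : 0 <= M * h by rewrite mulr_ge0 // ltW.
have Cl0 : 0 <= (1 + C1 + C2) * l by apply: mulr_ge0; [lra|exact: ltW].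
apply: covering_number_le_separated => [|m f fE sep].
  by apply: mulr_ge0 => //; rewrite le_min Mh0 divr_ge0 // ltW.
(* The quarter of the circle that contains [f i]. *)
pose sg (i : 'I_m) := (f i 0 0 < 0, f i 0 1 < 0).
have quarter (q : bool * bool) :
    #|[set i | sg i == q]%SET|%:R <= 512 * Q * l * M * h /\
    #|[set i | sg i == q]%SET|%:R * r <= 3.
  pose J : finType := {i : 'I_m | sg i == q}.
  have cJ : #|J| = #|[set i | sg i == q]%SET|.
    by rewrite card_sig; apply: eq_card => i; rewrite !inE.
  have [] := @quarter_bound R K c M h delta r J (fun j => f (val j)) q.1 q.2 K1 cK c0 d0 d2
    dr r1 M0 (powRN_sqr_ge s2 s1 d0 d2) h0 (powR_half_sqr d0 r0).
  - by move=> j; exact: fE.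
  - move=> i j ne; apply: sep; apply: contra ne => /eqP e; apply/eqP; exact: val_inj.
  - move=> j; have /eqP/(congr1 fst) /= <- := valP j.
    by case: ltP => le; rewrite ?expr1 ?expr0 ?mulN1r ?mul1r ?oppr_ge0 // ltW.
  - move=> j; have /eqP/(congr1 snd) /= <- := valP j.
    by case: ltP => le; rewrite ?expr1 ?expr0 ?mulN1r ?mul1r ?oppr_ge0 // ltW.
  rewrite cJ -/kappa -/l => le1 le2; split=> //.
  have e : 5040 * l / ln 2 / kappa = Q * l by rewrite /Q; ring.
  by rewrite e mulrA in le1.
have tot : m%:R = \sum_(q : bool * bool) #|[set i | sg i == q]%SET|%:R :> R.
  rewrite -natr_sum -[in LHS](card_ord m) -sum1_card (partition_big sg xpredT) //=.
  by congr _%:R; apply: eq_bigr => q _; rewrite sum1dep_card.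
have four (t : R) : \sum_(q : bool * bool) t = 4 * t.
  by rewrite sumr_const card_prod !card_bool mulr_natl.
have mMh : m%:R <= C1 * l * (M * h).
  rewrite tot; apply: le_trans (ler_sum _ (fun q _ => proj1 (quarter q))) _.
  rewrite four /C1 le_eqVlt; apply/orP; left; apply/eqP; ring.
have mr : m%:R * r <= 12.
  rewrite tot mulr_suml; apply: le_trans (ler_sum _ (fun q _ => proj2 (quarter q))) _.
  by rewrite four; lra.
have big (a : R) t : 0 <= t -> a <= 1 + C1 + C2 -> a * l * t <= (1 + C1 + C2) * l * t.
  move=> t0 le; apply: ler_wpM2r => //; apply: ler_wpM2r => //; exact: ltW.
case: (leP (M * h) (1 / r)) => _.
  by apply: le_trans mMh _; apply: big => //; lra.
rewrite mulrA mulr1 ler_pdivlMr //; apply: le_trans mr _.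
rewrite -[X in _ <= X]mulr1; apply: le_trans (_ : C2 * l * 1 <= _); last by apply: big => //; lra.
by rewrite mulr1 /C2 mulrAC ler_pdivlMr // ler_pM2l.
Qed.

(** * Sharpness *)

(** The height is 1-Lipschitz: each set of a cover projects into an interval of
    twice its diameter, and Lebesgue measure is countably subadditive. *)
Lemma content_ge_height (R : realType) (K : set 'rV[R]_2) (L : R) : 0 <= L ->
  (forall w, 0 <= w < L -> exists2 p, K p & p 0 1 = w) ->
  ((L / 2)%:E <= hausdorff_content1 K)%E.
Proof.
move=> L0 KL; apply: le_ereal_inf_tmp => _ [E /= KE <-].
pose I i : set R := if pselect (exists p, E i p) is left ex then
   (if diam (E i) is d%:E then [set` `[projT1 (cid ex) 0 1 - d, projT1 (cid ex) 0 1 + d]] else setT)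
   else set0.
have mI i : measurable (I i).
  by rewrite /I; case: pselect => // ex; case: (diam (E i)) => // d; exact: measurable_itv.
have muI i : (lebesgue_measure (I i) <= 2%:E * diam (E i))%E.
  rewrite /I; case: pselect => [ex|_]; last first.
    by rewrite measure0 mule_ge0 ?diam_ge0 // lee_fin.
  have := diam_ge0 (E i); case: (diam (E i)) => [d|_|//].
    rewrite lee_fin => d0; rewrite lebesgue_measure_itv /= lte_fin.
    case: ifP => _; rewrite -EFinM ?lee_fin ?mulr_ge0 //.
    by lra.
  by rewrite gt0_muley ?leey // lte_fin.
have cov : `[0, L[ `<=` \bigcup_i I i.
  move=> w; rewrite /= in_itv /= => /KL[p Kp <-]; have [i _ Eip] := KE _ Kp.
  exists i => //; rewrite /I; case: pselect => [ex|]; last by case; exists p.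
  case D : (diam (E i)) => [d||//].
    rewrite /= in_itv /=; set q := projT1 (cid ex).
    have Eiq : E i q by exact: projT2 (cid ex).
    have : ((enorm (p - q))%:E <= d%:E)%E.
      by rewrite -D; apply: ereal_sup_ubound; right; exists p, q.
    rewrite lee_fin => le; have := le_trans (coord1_le_enorm _) le; rewrite !mxE.
    by rewrite ler_norml => /andP[h1 h2]; apply/andP; split; lra.
  by have := diam_ge0 (E i); rewrite D.
have S0 : (0 <= \sum_(0 <= i <oo) diam (E i))%E.
  by apply: nneseries_ge0 => i _ _; exact: diam_ge0.
have muL : (lebesgue_measure (`[0%R, L[ : set R) = L%:E)%E.
  rewrite lebesgue_measure_itv /= lte_fin; case: ltP => [_|le]; first by rewrite sube0.
  by congr EFin; apply/eqP; rewrite eq_le L0 le.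
have leL : (L%:E <= \sum_(0 <= i <oo) lebesgue_measure (I i))%E.
  rewrite -muL; apply: measure_sigma_subadditive => //; exact: measurable_itv.
have : (L%:E <= 2%:E * \sum_(0 <= i <oo) diam (E i))%E.
  apply: le_trans leL _; rewrite -nneseriesZl => [|i _]; last exact: diam_ge0.
  by apply: lee_nneseries => i; [move=> _ _; exact: measure_ge0|move=> _; exact: muI].
case: (\sum_(0 <= i <oo) diam (E i))%E S0 => [x|_ _|//]; last by rewrite leey.
by rewrite -EFinM !lee_fin => _; lra.
Qed.

Lemma trunc_ge_half (R : archiRealFieldType) (x : R) : 1 <= x -> x / 2 <= (Num.trunc x)%:R.
Proof.
move=> x1; have x0 : 0 <= x by lra.
have /andP[_] := truncn_itv x0; have : (1 <= Num.trunc x)%N by rewrite truncn_ge_nat.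
by rewrite -(ler_nat R) -natr1; lra.
Qed.

Section Sharp.
Variables (R : realType) (M h r delta : R).
Hypothesis M0 : 0 < M.
Hypothesis M2 : 1 <= M ^+ 2 * delta.
Hypothesis d0 : 0 < delta.
Hypothesis d1 : delta <= 1.
Hypothesis r0 : 0 < r.
Hypothesis dr : delta <= r.
Hypothesis rM : r * M <= 1.
Hypothesis h0 : 0 < h.
Hypothesis h2 : h ^+ 2 * r = delta.

(** With [h = sqrt (delta / r)] this is [M * sqrt (delta * r)], and [gap] is
    [delta / omega]. *)
Definition omega : R := M * h * r.
Definition gap : R := h / M.
Definition ncol : nat := (Num.trunc (M ^+ 2 * r)).+1.
Definition nrow : nat := Num.trunc omega^-1.
Definition maxp : nat := Num.trunc (M * omega).
Definition maxq : nat := Num.trunc (M * r)^-1.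

Lemma h_le1 : h <= 1.
Proof.
rewrite -(@ler_pXn2r _ 2) ?nnegrE ?(ltW h0) // expr1n.
by rewrite -(ler_pM2r r0) h2 mul1r.
Qed.

Lemma M_ge1 : 1 <= M.
Proof.
have : 1 <= M ^+ 2 by apply: le_trans M2 _; rewrite ler_piMr ?sqr_ge0.
by rewrite -{1}(expr1n _ 2) ler_pXn2r ?nnegrE ?(ltW M0).
Qed.

Lemma omega_gt0 : 0 < omega.
Proof. by rewrite /omega !mulr_gt0. Qed.

Lemma gap_gt0 : 0 < gap.
Proof. by rewrite /gap divr_gt0. Qed.

Lemma omega_le1 : omega <= 1.
Proof.
have -> : omega = h * (r * M) by rewrite /omega; ring.
rewrite -[1]mulr1; apply: ler_pM; rewrite ?h_le1 // ?(ltW h0) //.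
by rewrite mulr_ge0 // ltW.
Qed.

Lemma gap_le1 : gap <= 1.
Proof. by rewrite /gap ler_pdivrMr // mul1r; apply: le_trans h_le1 M_ge1. Qed.

Lemma omega_gap : omega * gap = delta.
Proof. by rewrite /omega /gap -h2; field; exact: lt0r_neq0. Qed.

Lemma gapE : M ^+ 2 * r * gap = omega.
Proof. by rewrite /omega /gap; field; exact: lt0r_neq0. Qed.

Lemma M2r_ge1 : 1 <= M ^+ 2 * r.
Proof. by apply: le_trans M2 _; rewrite ler_pM2l // exprn_gt0. Qed.

Lemma M2r_gt0 : 0 < M ^+ 2 * r.
Proof. exact: lt_le_trans ltr01 M2r_ge1. Qed.

Lemma ncol_gap : ncol%:R * gap <= 2 * omega.
Proof.
rewrite -gapE mulrA ler_pM2r ?gap_gt0 // /ncol -natr1.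
have /andP[h1 _] := truncn_itv (ltW M2r_gt0); have := M2r_ge1; lra.
Qed.

Lemma nrow_omega : 1 / 2 <= nrow%:R * omega <= 1.
Proof.
have o0 := omega_gt0; apply/andP; split.
  rewrite -ler_pdivrMr // mul1r mulrC; apply: trunc_ge_half.
  by rewrite invf_ge1 // omega_le1.
rewrite -ler_pdivlMr // mul1r.
have i0 : 0 <= omega^-1 by rewrite invr_ge0 ltW.
by have /andP[] := truncn_itv i0.
Qed.

Lemma maxp_bounds : M * omega / 2 <= maxp%:R <= M * omega.
Proof.
have p0 : 0 <= M * omega by rewrite mulr_ge0 ?(ltW omega_gt0) // ltW.
apply/andP; split; last by have /andP[] := truncn_itv p0.
apply: trunc_ge_half.
have e : M * omega * h = M ^+ 2 * delta by rewrite /omega -h2; ring.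
by apply: le_trans M2 _; rewrite -e ler_piMr // h_le1.
Qed.

Lemma maxq_bounds : (M * r)^-1 / 2 <= maxq%:R <= (M * r)^-1.
Proof.
have p0 : 0 < M * r by rewrite mulr_gt0.
have i0 : 0 <= (M * r)^-1 by rewrite invr_ge0 ltW.
apply/andP; split; last by have /andP[] := truncn_itv i0.
by apply: trunc_ge_half; rewrite invf_ge1 // mulrC.
Qed.

Definition vec (a b : R) : 'rV[R]_2 := \row_j (if j == 0 then a else b).

Lemma vec0 a b : vec a b 0 0 = a. Proof. by rewrite mxE. Qed.
Lemma vec1 a b : vec a b 0 1 = b. Proof. by rewrite mxE. Qed.

(** The grid point in column [i] and row [k], raised by [i%:R * gap] and by [u]; the
    factor [1 / 16] brings everything into the unit ball. *)
Definition staircase_pt (i k : nat) (u : R) :=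
  vec (i%:R * gap / 16) ((k%:R * omega + i%:R * gap + u) / 16).

Definition staircase : set 'rV[R]_2 :=
  \bigcup_(ik in [set: 'I_ncol * 'I_nrow])
     [set staircase_pt ik.1 ik.2 u | u in `[0, gap]].

Lemma staircase_compact : compact staircase.
Proof.
rewrite /staircase (_ : setT = [set` [pred _ : 'I_ncol * 'I_nrow | true]]); last first.
  by apply/seteqP; split.
rewrite bigcup_pred; apply: bigsetU_compact => ik _.
set i : nat := ik.1; set k : nat := ik.2.
have -> : [set staircase_pt i k u | u in `[0, gap]] =
    [set staircase_pt i k 0 + u *: vec 0 (1 / 16) | u in `[0, gap]].
  apply: eq_imagel => u _; apply/rowP => j; rewrite !mxE.
  by case: ifP => _; ring.
apply: continuous_compact; last exact: segment_compact.
apply: continuous_subspaceT => u; apply: cvgD; first exact: cvg_cst.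
by apply: cvgZ; [exact: cvg_id|exact: cvg_cst].
Qed.

Lemma staircase_ball : staircase `<=` eball 0 1.
Proof.
move=> pt [[i k] _ [u /=]]; rewrite in_itv /= => /andP[u0 u1] <-.
rewrite /eball /= subr0.
have gi : 0 <= i%:R * gap <= 2 * omega.
  rewrite mulr_ge0 ?(ltW gap_gt0) //=; apply: le_trans ncol_gap.
  by rewrite ler_pM2r ?gap_gt0 // ler_nat ltnW.
have ki : 0 <= k%:R * omega <= 1.
  have /andP[_ le] := nrow_omega.
  rewrite mulr_ge0 ?(ltW omega_gt0) //=; apply: le_trans le.
  by rewrite ler_pM2r ?omega_gt0 // ler_nat ltnW.
have o1 := omega_le1; have g1 := gap_le1.
move: gi ki => /andP[gi0 gi1] /andP[ki0 ki1].
apply: le_trans (_ : 2 / 16 + 4 / 16 <= _); last by lra.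
by apply: enorm_le_coords; rewrite ?vec0 ?vec1 ger0_norm; lra.
Qed.

(** The segments of a row are stacked end to end in height, and a row is at least
    as high as the distance to the next one. *)
Lemma staircase_height w : 0 <= w < 1 / 32 -> exists2 p, staircase p & p 0 1 = w.
Proof.
move=> /andP[w0 w1]; have o0 := omega_gt0; have g0 := gap_gt0.
have q0 : 0 <= 16 * w / omega by rewrite divr_ge0 ?(ltW o0) // mulr_ge0.
have /andP[k1 k2] := truncn_itv q0; set k := Num.trunc _ in k1 k2.
rewrite ler_pdivlMr // in k1; rewrite ltr_pdivrMr // -natr1 in k2.
(* Successive division: [k] is the row, [i] the column, the last remainder is [u]. *)
pose rho := 16 * w - k%:R * omega.
have p0 : 0 <= rho / gap by rewrite divr_ge0 ?(ltW g0) // /rho subr_ge0.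
have /andP[i1 i2] := truncn_itv p0; set i := Num.trunc _ in i1 i2.
rewrite ler_pdivlMr // in i1; rewrite ltr_pdivrMr // -natr1 in i2.
have klt : (k < nrow)%N.
  rewrite -(ltr_nat R) -(ltr_pM2r o0); have /andP[n1 _] := nrow_omega; lra.
have ilt : (i < ncol)%N.
  rewrite /ncol ltnS; apply: le_truncn; rewrite ler_pdivrMr // gapE /rho; lra.
exists (staircase_pt i k (rho - i%:R * gap)).
  exists (Ordinal ilt, Ordinal klt) => //; exists (rho - i%:R * gap) => //=.
  by rewrite in_itv /=; apply/andP; split; lra.
by rewrite vec1 /rho; field.
Qed.

(** The weight [1 - tilt] on the abscissa cancels the shear of the rows, so that
    [tiltvec] sees the point in column [i] and row [k] at [gap * (i + k * p / q)]
    (see [staircase_proj]). *)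
Definition tilt (p q : nat) : R := p%:R / q%:R / (M ^+ 2 * r).
Definition tiltvec p q := vec (1 - tilt p q) (tilt p q).
Definition dir p q := (enorm (tiltvec p q))^-1 *: tiltvec p q.

Lemma dir0 p q : dir p q 0 0 = (enorm (tiltvec p q))^-1 * (1 - tilt p q).
Proof. by rewrite /dir /tiltvec !mxE. Qed.

Lemma dir1 p q : dir p q 0 1 = (enorm (tiltvec p q))^-1 * tilt p q.
Proof. by rewrite /dir /tiltvec !mxE. Qed.

Section OneDirection.
Variables p q : nat.
Hypotheses (pP : (p <= maxp)%N) (q0 : (0 < q)%N) (qQ : (q <= maxq)%N) (Qq : (maxq < 8 * q)%N).

Let qR : 0 < q%:R :> R. Proof. by rewrite ltr0n. Qed.

Lemma tilt_bounds : 0 <= tilt p q <= 16 * omega.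
Proof.
have m0 := M2r_gt0; rewrite /tilt; apply/andP; split.
  by rewrite divr_ge0 ?divr_ge0 // ltW.
rewrite ler_pdivrMr // ler_pdivrMr //.
have /andP[_ p1] := maxp_bounds; have /andP[q1 _] := maxq_bounds.
have p2 : p%:R <= M * omega by apply: le_trans p1; rewrite ler_nat.
have q2 : (M * r)^-1 / 2 <= 8 * q%:R.
  by apply: le_trans q1 _; rewrite -natrM ler_nat ltnW.
have Mr0 : 0 < M * r by rewrite mulr_gt0.
have q3 : 1 <= 16 * q%:R * (M * r).
  by rewrite -ler_pdivrMr // mul1r; lra.
apply: le_trans p2 _.
have -> : 16 * omega * (M ^+ 2 * r) * q%:R = M * omega * (16 * q%:R * (M * r)) by ring.
by rewrite ler_peMr // mulr_ge0 ?(ltW omega_gt0) // ltW.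
Qed.

Lemma enorm_tiltvec : 1 / 2 <= enorm (tiltvec p q) <= 32.
Proof.
have /andP[t0 t1] := tilt_bounds; have o1 := omega_le1.
apply/andP; split.
  rewrite -(@ler_pXn2r _ 2) ?nnegrE ?enorm_ge0 // sqr_enorm vec0 vec1.
  have := sqr_ge0 (1 - 2 * tilt p q); nra.
apply: le_trans (_ : 16 + 16 <= _); last by lra.
apply: enorm_le_coords; rewrite ?vec0 ?vec1.
  by rewrite ler_norml; apply/andP; split; lra.
by rewrite ger0_norm //; lra.
Qed.

Lemma enorm_tiltvec_gt0 : 0 < enorm (tiltvec p q).
Proof. by have /andP[h1 _] := enorm_tiltvec; lra. Qed.

Lemma enormZ (c : R) (v : 'rV[R]_2) : enorm (c *: v) = `|c| * enorm v.
Proof.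
rewrite /enorm !dotpE !mxE -sqrtr_sqr -sqrtrM ?sqr_ge0 //; congr Num.sqrt; ring.
Qed.

Lemma dir_unit : unit_circle R (dir p q).
Proof.
rewrite /unit_circle /= /dir enormZ ger0_norm ?invr_ge0 ?enorm_ge0 //.
by rewrite mulVf // lt0r_neq0 // enorm_tiltvec_gt0.
Qed.

Lemma staircase_proj i k u : dotp (staircase_pt i k u) (dir p q) =
  gap / q%:R / (16 * enorm (tiltvec p q)) * (i * q + k * p)%:R
   + tilt p q * u / (16 * enorm (tiltvec p q)).
Proof.
have En := lt0r_neq0 enorm_tiltvec_gt0; have qn := lt0r_neq0 qR.
rewrite dotpE dir0 dir1 vec0 vec1.
have e : tilt p q * omega = gap * p%:R / q%:R.
  by rewrite -gapE /tilt; field; rewrite qn !lt0r_neq0.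
rewrite natrD !natrM; set E := enorm _ in En *.
transitivity ((i%:R * gap + tilt p q * omega * k%:R + tilt p q * u) / (16 * E)).
  by field.
by rewrite e; field; rewrite En qn.
Qed.

(** The values [i * q + k * p] are natural numbers of size [O(M)], and a vertical
    segment spreads its value by at most [2 delta] since [tilt] is [O(omega)]. *)
Lemma staircase_small_proj :
  (covering_number (orthoproj (dir p q) @` staircase) delta <= (4 * M)%:E)%E.
Proof.
have E0 := enorm_tiltvec_gt0; have /andP[E1 _] := enorm_tiltvec.
have /andP[t0 t1] := tilt_bounds; have g0 := gap_gt0; have o0 := omega_gt0.
pose N := (ncol * maxq + nrow * maxp).+1.
apply: le_trans (_ : (N%:R%:E <= _)%E); last first.
  rewrite lee_fin /N -natr1 natrD !natrM.
  have m1 := M_ge1; have /andP[_ qb] := maxq_bounds; have /andP[_ pb] := maxp_bounds.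
  have /andP[_ nb] := nrow_omega.
  have c1 : ncol%:R * maxq%:R <= 2 * M.
    have cb : ncol%:R <= 2 * (M ^+ 2 * r).
      by rewrite -(ler_pM2r g0) -mulrA gapE; exact: ncol_gap.
    apply: le_trans (ler_pM _ _ cb qb) _; rewrite ?ler0n //.
    by rewrite le_eqVlt; apply/orP; left; apply/eqP; field; rewrite !lt0r_neq0.
  have c2 : nrow%:R * maxp%:R <= M.
    apply: le_trans (ler_wpM2l (ler0n _ _) pb) _.
    by rewrite mulrCA ler_piMr // ltW.
  lra.
apply: (@covering_number_le _ _ _ _ (fun m : 'I_N =>
   (gap / q%:R / (16 * enorm (tiltvec p q)) * m%:R + delta) *: dir p q)).
move=> pt [pt' [[i k] _ [u /=]]]; rewrite in_itv /= => /andP[u0 u1] <- <-.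
have mN : (i * q + k * p < N)%N.
  by rewrite ltnS leq_add // leq_mul // ltnW.
exists (Ordinal mN) => //; rewrite /eball /= /orthoproj staircase_proj -scalerBl enormZ.
rewrite dir_unit mulr1.
set G := _ * (_ + _)%:R; set v := tilt p q * u / _.
have -> : G + v - (G + delta) = v - delta by ring.
have v0 : 0 <= v := divr_ge0 (mulr_ge0 t0 u0) (mulr_ge0 (ler0n R 16) (ltW E0)).
have v1 : v <= 2 * delta.
  rewrite /v ler_pdivrMr ?mulr_gt0 //.
  have : tilt p q * u <= 16 * omega * gap by apply: ler_pM.
  rewrite -mulrA omega_gap => le; apply: le_trans le _.
  by have := d0; nra.
by rewrite ler_norml; apply/andP; split; lra.
Qed.
End OneDirection.

Lemma tilt_dir_le p q p' q' (rho : R) (z : 'rV[R]_2) :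
  (p <= maxp)%N -> (0 < q)%N -> (q <= maxq)%N -> (maxq < 8 * q)%N ->
  (p' <= maxp)%N -> (0 < q')%N -> (q' <= maxq)%N -> (maxq < 8 * q')%N ->
  eball z rho (dir p q) -> eball z rho (dir p' q') ->
  `|tilt p q - tilt p' q'| <= 32 ^+ 2 * (4 * rho).
Proof.
move=> pP qp qQ Qq pP' qp' qQ' Qq' b1 b2.
have E0 := enorm_tiltvec_gt0 pP qp Qq; have E0' := enorm_tiltvec_gt0 pP' qp' Qq'.
have /andP[_ E1] := enorm_tiltvec pP qp Qq; have /andP[_ E1'] := enorm_tiltvec pP' qp' Qq'.
have U := dir_unit pP qp Qq; have U' := dir_unit pP' qp' Qq'.
set e := dir p q in b1 U; set e' := dir p' q' in b2 U'.
have e0 : `|e 0 0| <= 1 by rewrite -U; exact: coord0_le_enorm.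
have e1 : `|e 0 1| <= 1 by rewrite -U; exact: coord1_le_enorm.
have c0 : `|e' 0 0 - e 0 0| <= 2 * rho.
  have := le_trans (coord0_le_enorm _) b1; have := le_trans (coord0_le_enorm _) b2.
  rewrite !mxE !ler_norml => /andP[? ?] /andP[? ?]; apply/andP; split; lra.
have c1 : `|e' 0 1 - e 0 1| <= 2 * rho.
  have := le_trans (coord1_le_enorm _) b1; have := le_trans (coord1_le_enorm _) b2.
  rewrite !mxE !ler_norml => /andP[? ?] /andP[? ?]; apply/andP; split; lra.
have -> : tilt p q - tilt p' q' = enorm (tiltvec p q) * enorm (tiltvec p' q') *
    (e 0 1 * (e' 0 0 - e 0 0) - e 0 0 * (e' 0 1 - e 0 1)).
  rewrite /e /e' !dir0 !dir1.
  by field; rewrite !lt0r_neq0.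
rewrite normrM; apply: ler_pM; rewrite ?normr_ge0 //.
  by rewrite normrM !ger0_norm ?enorm_ge0 // expr2; apply: ler_pM; rewrite ?enorm_ge0.
apply: le_trans (ler_normB _ _) _; rewrite !normrM.
have : `|e 0 1| * `|e' 0 0 - e 0 0| <= 1 * (2 * rho) by apply: ler_pM.
have : `|e 0 0| * `|e' 0 1 - e 0 1| <= 1 * (2 * rho) by apply: ler_pM.
lra.
Qed.

(** Distinct fractions with denominators up to [Q] differ by at least [Q ^- 2]. *)
Lemma tilt_gap p q p' q' : coprime p q -> coprime p' q' ->
  (0 < q <= maxq)%N -> (0 < q' <= maxq)%N -> (p, q) != (p', q') ->
  r <= `|tilt p q - tilt p' q'|.
Proof.
move=> c1 c2 hq hq' ne; have := coprime_fraction_gap R c1 c2 hq hq' ne.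
have m0 := M2r_gt0.
have -> : tilt p q - tilt p' q' = (p%:R / q%:R - p'%:R / q'%:R) / (M ^+ 2 * r).
  by rewrite /tilt mulrBl.
move=> le; rewrite normrM normfV (gtr0_norm m0) ler_pdivlMr //; apply: le_trans le.
have /andP[_ qb] := maxq_bounds; have Mr0 : 0 < M * r by rewrite mulr_gt0.
have Q0 : 0 < maxq%:R :> R.
  by case/andP: hq => q1 q2; rewrite ltr0n (leq_trans q1).
have le : maxq%:R * (M * r) <= 1 by rewrite -ler_pdivlMr // mul1r.
rewrite -[leRHS]mul1r ler_pdivlMr ?exprn_gt0 //.
have -> : r * (M ^+ 2 * r) * maxq%:R ^+ 2 = (maxq%:R * (M * r)) ^+ 2 by ring.
by rewrite expr_le1 // mulr_ge0 // ltW.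
Qed.

(** A ball of radius [r] contains boundedly many of the [r]-separated directions
    given by [large_coprime_pairs]. *)
Lemma many_small_dirs :
  ((M * h / (32 * (16 * 32 ^+ 2 + 1)))%:E
    <= covering_number (small_proj_dirs staircase delta (4 * M)) r)%E.
Proof.
set D : R := 32 ^+ 2; have D0 : 0 < D by rewrite exprn_gt0.
apply: le_ereal_inf_tmp => _ [n /= [z cov] <-]; rewrite lee_fin.
pose F := large_coprime_pairs maxp maxq.
have FP f : f \in F -> [/\ coprime f.1.+1 f.2.+1, (f.1.+1 <= maxp)%N, (0 < f.2.+1)%N,
    (f.2.+1 <= maxq)%N & (maxq < 8 * f.2.+1)%N].
  by rewrite inE => /andP[c1 c2]; split.
(* [g f] is the index of a ball that contains the direction of [f]. *)
have /choice[g gP] : forall f : 'I_maxp * 'I_maxq, exists k : option 'I_n,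
    f \in F -> exists2 i, k = Some i & eball (z i) r (dir f.1.+1 f.2.+1).
  move=> f; case: (boolP (f \in F)) => [fF|_]; last by exists None.
  have [c1 c2 c3 c4 c5] := FP _ fF.
  have [|i _ hi] := cov (dir f.1.+1 f.2.+1); last by exists (Some i) => _; exists i.
  by split; [exact: dir_unit|exact: staircase_small_proj].
have fiber (i : 'I_n) : #|[set f in F | g f == Some i]%SET|%:R <= 16 * D + 1.
  set A := [set f in F | g f == Some i]%SET.
  have AP f : f \in A -> f \in F /\ eball (z i) r (dir f.1.+1 f.2.+1).
    by rewrite inE => /andP[fF /eqP e]; split=> //; have [j] := gP _ fF; rewrite e => -[->].
  have [->|[f0 /AP[f0F b0]]] := set_0Vmem A.
    by rewrite cards0 addr_ge0 // mulr_ge0 // ltW.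
  have r2 : 0 < r / 2 by rewrite divr_gt0.
  have := @card_separated R _ A (fun f => tilt f.1.+1 f.2.+1) (r / 2)
    (tilt f0.1.+1 f0.2.+1 - D * (4 * r)) (2 * (D * (4 * r))) r2.
  have Dr : 0 <= D * (4 * r) by rewrite !mulr_ge0 // ltW.
  have D2r : 0 <= 2 * (D * (4 * r)) by rewrite mulr_ge0.
  move=> /(_ D2r) H.
  rewrite -(ler_pM2r r2) mulrDl mul1r.
  have -> : 16 * D * (r / 2) = 2 * (D * (4 * r)) by field.
  apply: H => [f f' /AP[fF _] /AP[fF' _] ne|f /AP[fF bf]].
    have [c1 c2 c3 c4 c5] := FP _ fF; have [c1' c2' c3' c4' c5'] := FP _ fF'.
    apply: lt_le_trans (_ : r <= _); first by have := r0; lra.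
    apply: tilt_gap => //; apply: contra ne => /eqP[e1 e2].
  have [c1 c2 c3 c4 c5] := FP _ fF; have [c1' c2' c3' c4' c5'] := FP _ f0F.
  have := tilt_dir_le c2 c3 c4 c5 c2' c3' c4' c5' bf b0.
  by rewrite -/D ler_norml => /andP[? ?]; apply/andP; split; lra.
have cF : #|F|%:R <= (16 * D + 1) * n%:R.
  have sub : F \subset (\bigcup_(i : 'I_n) [set f in F | g f == Some i])%SET.
    apply/fintype.subsetP => f fF; have [i e _] := gP _ fF.
    by apply/finset.bigcupP; exists i => //; rewrite inE fF e eqxx.
  have le1 : (#|F| <= \sum_(i < n) #|[set f in F | g f == Some i]%SET|)%N.
    apply: leq_trans (subset_leq_card sub) _.
    elim/big_rec2 : _ => [|d s A _ le]; first by rewrite cards0.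
    by apply: leq_trans (leq_card_setU _ _) _; rewrite leq_add2l.
  apply: le_trans (_ : (\sum_(i < n) #|[set f in F | g f == Some i]%SET|)%:R <= _).
    by rewrite ler_nat.
  rewrite natr_sum; apply: le_trans (ler_sum _ (fun i _ => fiber i)) _.
  by rewrite sumr_const card_ord mulr_natr.
have PQ : maxp%:R * maxq%:R <= 8 * #|F|%:R :> R.
  by rewrite -!natrM ler_nat; exact: card_large_coprime_pairs.
have /andP[pb _] := maxp_bounds; have /andP[qb _] := maxq_bounds.
have Mr0 : 0 < M * r by rewrite mulr_gt0.
have o0 := omega_gt0.
have le : M * h / 4 <= maxp%:R * maxq%:R.
  apply: le_trans (_ : (M * omega / 2) * ((M * r)^-1 / 2) <= _).
    by rewrite le_eqVlt; apply/orP; left; apply/eqP; rewrite /omega; field; rewrite !lt0r_neq0.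
  apply: ler_pM => //; first by rewrite divr_ge0 // mulr_ge0 // ltW.
  by rewrite divr_ge0 // invr_ge0 ltW.
have C0 : 0 < 16 * D + 1 by rewrite addr_gt0 // mulr_gt0.
rewrite ler_pdivrMr ?mulr_gt0 //; lra.
Qed.
End Sharp.

Lemma sharpness (R : realType) : exists c0 C0 : R, [/\ 0 < c0, 1 <= C0 &
  forall s delta r : R, 1 / 2 <= s -> s < 1 -> 0 < delta -> delta <= 1 / 2 ->
    delta <= r -> r <= delta `^ s ->
    exists K : set 'rV[R]_2, [/\ compact K, K `<=` eball 0 1,
      (c0%:E <= hausdorff_content1 K)%E &
      ((c0 * (delta `^ (- s) * (delta / r) `^ (1 / 2)))%:E
        <= covering_number (small_proj_dirs K delta (C0 * delta `^ (- s))) r)%E]].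
Proof.
set c1 : R := 32 * (16 * 32 ^+ 2 + 1).
have D0 : 0 < 32 ^+ 2 :> R by rewrite exprn_gt0.
have c10 : 64 <= c1 by rewrite /c1; nra.
exists c1^-1, 4; split; [by rewrite invr_gt0; lra|by lra|].
move=> s delta r s2 s1 d0 d2 dr rs.
have r0 : 0 < r by apply: lt_le_trans dr.
set M := delta `^ (- s); set h := (delta / r) `^ (1 / 2).
have M0 : 0 < M by rewrite powR_gt0.
have h0 : 0 < h by exact: powR_half_gt0.
have h2 : h ^+ 2 * r = delta by rewrite (powR_half_sqr d0 r0) divfK // lt0r_neq0.
have M2 : 1 <= M ^+ 2 * delta by exact: powRN_sqr_ge.
have rM : r * M <= 1 by exact: powRN_mul_rad_le.
have d1 : delta <= 1 by lra.
exists (staircase M h r); split.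
- exact: staircase_compact.
- by apply: (@staircase_ball R M h r delta).
- apply: le_trans (content_ge_height (L := 1 / 32) _ _); last 2 first.
  + by rewrite divr_ge0.
  + by move=> w; apply: (@staircase_height R M h r delta).
  by rewrite lee_fin (_ : 1 / 32 / 2 = 64^-1 :> R); [rewrite lef_pV2 ?posrE //; lra|field].
- have := many_small_dirs M0 M2 d0 d1 r0 dr rM h0 h2.
  by rewrite -/c1 [X in X%:E]mulrC.
Qed.

Theorem theorem1p5 (R : realType) :
  (forall c : R, 0 < c ->
     exists2 C : R, 1 <= C &
       forall (K : set 'rV[R]_2) (s delta r : R),
         compact K -> K `<=` eball 0 1 ->
         (c%:E <= hausdorff_content1 K)%E ->
         1 / 2 <= s -> s < 1 ->
         0 < delta -> delta <= 1 / 2 ->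
         delta <= r -> r <= 1 ->
         (covering_number (small_proj_dirs K delta (delta `^ (- s))) r
          <= (C * ln (1 / delta) *
              Num.min (delta `^ (- s) * (delta / r) `^ (1 / 2)) (1 / r))%:E)%E)
  /\
  (exists c0 C0 : R, [/\ 0 < c0, 1 <= C0 &
     forall s delta r : R,
       1 / 2 <= s -> s < 1 ->
       0 < delta -> delta <= 1 / 2 ->
       delta <= r -> r <= delta `^ s ->
       exists K : set 'rV[R]_2,
         [/\ compact K, K `<=` eball 0 1,
             (c0%:E <= hausdorff_content1 K)%E &
             ((c0 * (delta `^ (- s) * (delta / r) `^ (1 / 2)))%:E
              <= covering_number
                   (small_proj_dirs K delta (C0 * delta `^ (- s))) r)%E]]).

Proof.
split; last exact: sharpness.
move=> c c0; have [C C1 bound] := upper_bound c0.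
by exists C => // K s delta r _; exact: bound.
Qed.
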